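(* Let $s\in(0,1)$ and let $E\subset\mathbb{R}^n$ be $s$-minimal in the open set $\Omega\subset\mathbb{R}^n$. If $x\in\partial E\cap\Omega$ and $E\cap\Omega$ has an interior tangent ball at $x$ (i.e. there is an open ball $B\subset E\cap\Omega$ with $x\in\partial B$), then $$\limsup_{\delta\to0}\mathcal{I}_s^\delta[E](x)\le0.$$
   Context: $\mathcal{C}E$ denotes the complement. For disjoint measurable $A,B$, $\mathcal{L}_s(A,B):=\int_A\int_B\frac{dx\,dy}{|x-y|^{n+s}}$, and $P_s(E,\Omega):=\mathcal{L}_s(E\cap\Omega,\mathcal{C}E)+\mathcal{L}_s(E\setminus\Omega,\mathcal{C}E\cap\Omega)$. $E$ is $s$-minimal in $\Omega$ if $P_s(E,\Omega)<\infty$ and $P_s(E,\Omega)\le P_s(F,\Omega)$ for every measurable $F\subset\mathbb{R}^n$ with $F\setminus\Omega=E\setminus\Omega$. For $\delta>0$, $\mathcal{I}_s^\delta[E](x):=\int_{\mathbb{R}^n\setminus B_\delta(x)}\frac{\chi_E(y)-\chi_{\mathcal{C}E}(y)}{|x-y|^{n+s}}\,dy$. Standing convention: every set $E$ is modified on a null set so that $E_1\subset E$ and $E\cap E_0=\emptyset$, where $E_1=\{x:\exists r>0,\ |E\cap B_r(x)|=\omega_nr^n\}$ and $E_0=\{x:\exists r>0,\ |E\cap B_r(x)|=0\}$, and so that $\partial E=\{x: 0<|E\cap B_r(x)|<\omega_nr^n\ \forall r>0\}$; $\omega_n=|B_1|$. *)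

(* Defs.v *)
From HB Require Import structures.
From mathcomp Require Import all_boot all_order all_algebra.
From mathcomp Require Import all_classical all_reals all_analysis.

Set Implicit Arguments.
Unset Strict Implicit.
Unset Printing Implicit Defensive.

Import Order.TTheory GRing.Theory Num.Theory.
Import numFieldNormedType.Exports.

Local Open Scope classical_set_scope.
Local Open Scope ring_scope.
Local Open Scope ereal_scope.

Section lebesgue_rV.
Context {R : realType} {n : nat}.
Implicit Types (A : set 'rV[R]_n) (B : option ('rV[R]_n * 'rV[R]_n)).

(* [None] is the empty box; without it nothing of volume 0 covers the empty
   set when [n = 0]. *)
Definition box B : set 'rV[R]_n :=
  if B is Some (a, b) then
    [set x | forall i, (a ord0 i < x ord0 i <= b ord0 i)%R]
  else set0.

Definition box_volume B : \bar R :=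
  if B is Some (a, b) then
    (\prod_(i < n) Num.max 0 (b ord0 i - a ord0 i))%:E
  else 0.

Definition lebesgue_outer A : \bar R :=
  ereal_inf [set \sum_(k <oo) box_volume (F k) |
    F in [set F : (option ('rV[R]_n * 'rV[R]_n))^nat |
            A `<=` \bigcup_k box (F k)]].

Lemma box_volume_ge0 B : 0 <= box_volume B.
Proof.
case: B => [[a b]|] //=; rewrite lee_fin.
by apply: prodr_ge0 => i _; rewrite le_max lexx.
Qed.

Fact lebesgue_outer_ge0 A : 0 <= lebesgue_outer A.
Proof.
apply: le_ereal_inf_tmp => _ [F _ <-].
by apply: nneseries_ge0 => k _ _; exact: box_volume_ge0.
Qed.

Fact lebesgue_outer0 : lebesgue_outer set0 = 0.
Proof.
apply/eqP; rewrite eq_le lebesgue_outer_ge0 andbT.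
apply: ereal_inf_lbound; exists (fun=> None); first by move=> x.
by rewrite eseries0.
Qed.

Fact le_lebesgue_outer : {homo lebesgue_outer : A B / A `<=` B >-> A <= B}.
Proof.
move=> A B AB; apply/ereal_inf_le_tmp => x [F BF <-].
by exists F => //; exact: subset_trans AB BF.
Qed.

Fact lebesgue_outer_sigma_subadditive : sigma_subadditive lebesgue_outer.
Proof.
move=> A; have [[i ioo]|] := pselect (exists i, lebesgue_outer (A i) = +oo).
  by rewrite (eseries_pinfty _ _ ioo) ?leey// => k _;
    rewrite -ltNye (lt_le_trans _ (lebesgue_outer_ge0 _)).
rewrite -forallNE => Aoo.
apply/lee_addgt0Pr => e e0.
apply: (le_trans _ (epsilon_trick _ _ (ltW e0))); last first.
  by move=> k; exact: lebesgue_outer_ge0.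
pose P k (F : (option ('rV[R]_n * 'rV[R]_n))^nat) :=
  A k `<=` \bigcup_j box (F j) /\
  \sum_(j <oo) box_volume (F j) <= lebesgue_outer (A k) + (e / (2 ^ k.+1)%:R)%:E.
have [G PG] : {G : nat -> (option ('rV[R]_n * 'rV[R]_n))^nat &
    forall k, P k (G k)}.
  apply: (@choice _ _ P) => k.
  have Afin : lebesgue_outer (A k) \is a fin_num.
    by rewrite ge0_fin_numE ?lebesgue_outer_ge0// ltey; exact/eqP/Aoo.
  have ek : (0 < e / (2 ^ k.+1)%:R)%R by rewrite divr_gt0// ltr0n expn_gt0.
  have [_ [F AF <-] Flt] := lb_ereal_inf_adherent ek Afin.
  by exists F; split => //; exact: ltW.
have /card_esym/ppcard_eqP[f] := card_nat2.
apply: (@le_trans _ _ (\sum_(k <oo) box_volume (uncurry G (f k)))).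
  apply: ereal_inf_lbound; exists (uncurry G \o f) => //= x [k _ Akx].
  have [j _ Gx] := (PG k).1 _ Akx.
  by exists (f^-1%FUN (k, j)) => //=; rewrite invK ?inE.
have vol0 p : 0 <= (box_volume \o uncurry G) p by exact: box_volume_ge0.
rewrite nneseries_esumT; last by move=> k; exact: box_volume_ge0.
rewrite -(reindex_esum [set: nat] [set: nat * nat] f
  (box_volume \o uncurry G))//.
have -> : [set: nat * nat] = [set: nat] `*`` (fun=> [set: nat]).
  by apply/seteqP; split.
rewrite (_ : esum _ _ =
  \esum_(k in [set: nat]) \esum_(j in [set: nat]) box_volume (G k j)); last first.
  rewrite esum_esum; last by move=> k j _ _; exact: box_volume_ge0.
  by apply: eq_esum => -[k j].
rewrite -nneseries_esumT; last first.
  by move=> k; apply: esum_ge0 => j _; exact: box_volume_ge0.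
apply: lee_nneseries => k _.
  by move=> _; apply: esum_ge0 => j _; exact: box_volume_ge0.
rewrite -nneseries_esumT; last by move=> j; exact: box_volume_ge0.
exact: (PG k).2.
Qed.

HB.instance Definition _ := isOuterMeasure.Build R 'rV[R]_n lebesgue_outer
  lebesgue_outer0 lebesgue_outer_ge0 le_lebesgue_outer
  lebesgue_outer_sigma_subadditive.

Definition lebesgue_measurable A : Prop :=
  lebesgue_outer.-cara.-measurable A.

Definition lebesgue : set (caratheodory_type lebesgue_outer) -> \bar R :=
  lebesgue_outer.

HB.instance Definition _ := isMeasure.Build _ _ _ lebesgue
  (@caratheodory_measure0 _ _ lebesgue_outer)
  (@caratheodory_measure_ge0 _ _ lebesgue_outer)
  (@caratheodory_measure_sigma_additive _ _ lebesgue_outer).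

End lebesgue_rV.

Local Close Scope ereal_scope.

Section nonlocal.
Context {R : realType} {n : nat}.
Implicit Types (s delta r : R) (x y c : 'rV[R]_n) (A B E F Omega : set 'rV[R]_n).

(* The library's norm on ['rV[R]_n] is the sup norm; it induces the same
   topology. *)
Definition enorm x : R := Num.sqrt (\sum_(i < n) x ord0 i ^+ 2).

Definition eball c r : set 'rV[R]_n := [set y | enorm (y - c) < r].

Definition boundary A : set 'rV[R]_n := closure A `\` interior A.

Definition frac_kernel s x y : R := (enorm (x - y) `^ (n%:R + s))^-1.

Definition interaction s A B : \bar R :=
  (\int[lebesgue]_(x in A) \int[lebesgue]_(y in B) (frac_kernel s x y)%:E)%E.

Definition s_perimeter s E Omega : \bar R :=
  (interaction s (E `&` Omega) (~` E) +
   interaction s (E `\` Omega) (~` E `&` Omega))%E.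

Definition s_minimal s E Omega : Prop :=
  [/\ lebesgue_measurable E,
      (s_perimeter s E Omega < +oo)%E &
      forall F, lebesgue_measurable F -> F `\` Omega = E `\` Omega ->
        (s_perimeter s E Omega <= s_perimeter s F Omega)%E].

Definition truncated_curvature s E x delta : \bar R :=
  (\int[lebesgue]_(y in ~` eball x delta)
     ((\1_E y - \1_(~` E) y) * frac_kernel s x y)%:E)%E.

(* omega_n r^n *)
Definition ball_volume r : \bar R := (lebesgue (eball 0 1) * (r ^+ n)%:E)%E.

Definition measure_interior E : set 'rV[R]_n :=
  [set x | exists2 r : R, 0 < r & lebesgue (E `&` eball x r) = ball_volume r].

Definition measure_exterior E : set 'rV[R]_n :=
  [set x | exists2 r : R, 0 < r & lebesgue (E `&` eball x r) = 0%E].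

Definition normalized E : Prop :=
  [/\ measure_interior E `<=` E,
      E `&` measure_exterior E = set0 &
      boundary E = [set x | forall r, 0 < r ->
        (0 < lebesgue (E `&` eball x r) < ball_volume r)%E]].

Definition interior_tangent_ball A x : Prop :=
  exists c r, [/\ 0 < r, eball c r `<=` A & boundary (eball c r) x].

End nonlocal.

(* Main.v *)
(** Suppose the limsup is positive, and let [c], [r] be the centre and radius of
the interior tangent ball.  The function [phi y = |y - c|^2 + |y - x|^2] is at
most [r^2] at [x], and the set [A = {phi < r^2 + tau^2} \ E] has positive
measure and is contained in the ball of radius [tau] around [x].  Comparing [E]
with its union with [A] gives [L(A, E) <= L(A, C(E u A))], and this is
contradicted by a calibration argument.  For [z] in [A] replace, near [x], the
function [chi_E - chi_CE] by the sign of [phi z - phi y].  The replacement only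
decreases the integrand off [A]; on [A x A] it is antisymmetric and contributes
nothing; and its singular integral at [z] is bounded below by
[- C delta^(1 - s)], because under the reflection about [z] only the part of the
slab [|grad phi(z).(y - z)| <= 2 |y - z|^2] in the ball of radius [delta] fails
to cancel.  Away from [x],
  the integral of [chi_E - chi_CE] at [z] is close to the
truncated curvature at [x], which is bounded away from [0] by assumption.  The
kernel is truncated by constants [m] to make all integrals finite, and then [m]
tends to infinity. *)

From HB Require Import structures.
Require Import Defs.
From mathcomp Require Import all_boot all_order all_algebra.
From mathcomp Require Import all_classical all_reals all_analysis.
From mathcomp Require Import measurable_realfun.
From mathcomp Require Import ring lra.

Set Implicit Arguments.
Unset Strict Implicit.
Unset Printing Implicit Defensive.

Import Order.TTheory GRing.Theory Num.Theory.
Import numFieldNormedType.Exports.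

Local Open Scope classical_set_scope.
Local Open Scope ring_scope.

(** * Lebesgue measure on row vectors *)

Section outer_measure.
Context {R : realType} {n : nat}.
Implicit Types (A X : set 'rV[R]_n) (B : option ('rV[R]_n * 'rV[R]_n)).

(** The slab is harmless because of one extra power of the radius: at scale rho its volume is of
    order rho^(n+1), against a kernel of order rho^(-n-s), and rho^(1-s) is summable over dyadic
    scales because s < 1. This requires a gradient bounded away from 0 uniformly in z, so a nonzero
    coordinate of [x - c] is fixed at the outset and tau is small compared with it. The constants
    are chosen in the order b, delta, eta, tau, and then m. At radius delta the truncated curvature
    exceeds b and the slab costs at most b/8. Since tau comes after delta, moving the centre from x
    to z loses at most b/2 far away, and the thin ring between balls with different centres costs at
    most b/8. A margin b/4 remains at each z, hence b/4 times |A| after integration. Cancelling the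
    terms on A x A is a subtraction, so they must be finite; this is what the bounded kernel
    provides. The margin is independent of m and survives the limit. *)

Lemma lebesgue_outer_box_le B : (lebesgue_outer (box B) <= box_volume B)%E.
Proof.
pose F (k : nat) : option ('rV[R]_n * 'rV[R]_n) := if k == 0%N then B else None.
have -> : box_volume B = (\sum_(k <oo) box_volume (F k))%E.
  rewrite (@nneseries_split _ _ 0 1) => [|k _]; last exact: box_volume_ge0.
  by rewrite big_nat1 eseries0 ?adde0// => -[|k].
by apply: ereal_inf_lbound; exists F => //; move=> x Bx; exists 0%N.
Qed.

(** Summing the bound over the boxes of a cover reduces a claim about all sets to boxes. It serves
    for the Caratheodory splitting by a half-space and for preimages under affine maps. *)
Lemma le_lebesgue_outer_of_box (nu : set 'rV[R]_n -> \bar R) (c : R) :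
  0 <= c -> {homo nu : A X / A `<=` X >-> (A <= X)%E} ->
  (forall A, (0 <= nu A)%E) -> sigma_subadditive nu ->
  (forall B, (nu (box B) <= c%:E * box_volume B)%E) ->
  forall A, (nu A <= c%:E * lebesgue_outer A)%E.
Proof.
move=> c0 nu_homo nu_ge0 nu_sub nu_box A.
have le_cover F : A `<=` \bigcup_k box (F k) ->
    (nu A <= c%:E * \sum_(k <oo) box_volume (F k))%E.
  move=> AF; apply: (le_trans (nu_homo _ _ AF)); apply: (le_trans (nu_sub _)).
  rewrite -nneseriesZl//; last by move=> k _; exact: box_volume_ge0.
  by apply: lee_nneseries => // k _.
(* Passing to the infimum over covers divides by [c]. For [c = 0] a single cover, by growing cubes,
   suffices: its total volume may be infinite, but 0 times it is 0. *)
move: c0; rewrite le_eqVlt => /predU1P[c0|c0].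
  rewrite -c0 mul0e.
  pose F k : option ('rV[R]_n * 'rV[R]_n) :=
    Some (\row__ (- k%:R), \row__ k%:R).
  have /le_cover : A `<=` \bigcup_k box (F k).
    move=> x _; pose M := \sum_(i < n) `|x ord0 i|.
    have xM i : `|x ord0 i| <= M.
      by rewrite /M (bigD1 i)//= lerDl sumr_ge0.
    exists (Num.truncn M).+1 => //= i; rewrite !mxE.
    have MM := truncnS_gt M; have := le_lt_trans (xM i) MM.
    by rewrite ltr_norml => /andP[-> /ltW->].
  by rewrite -c0 mul0e.
rewrite -lee_pdivrMl//; apply: le_ereal_inf_tmp => _ [F AF <-].
by rewrite lee_pdivrMl//; exact: le_cover.
Qed.

Lemma prod_max0_split (i : 'I_n) (u v w : 'I_n -> R) :
  (forall j, j != i -> v j = u j) -> (forall j, j != i -> w j = u j) ->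
  Num.max 0 (v i) + Num.max 0 (w i) = Num.max 0 (u i) ->
  \prod_j Num.max 0 (v j) + \prod_j Num.max 0 (w j) = \prod_j Num.max 0 (u j).
Proof.
move=> vu wu vwu; have prodE (f : 'I_n -> R) : (forall j,
  j != i -> f j = u j) ->
    \prod_j Num.max 0 (f j) =
    Num.max 0 (f i) * \prod_(j | j != i) Num.max 0 (u j).
  by move=> fu; rewrite (bigD1 i)//=; congr (_ * _); apply: eq_bigr => j /fu->.
by rewrite !prodE// -mulrDl vwu.
Qed.

(** Caratheodory's inequality only has to be checked on a box, where the hyperplane cuts one side in
    two. Boxes are open on the left and closed on the right, so the two pieces lie in boxes whose
    volumes add up exactly. *)
Lemma lebesgue_measurable_halfspace (i : 'I_n) (t : R) :
  lebesgue_measurable [set x : 'rV[R]_n | x ord0 i <= t].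
Proof.
set H := [set x | _]; apply: le_caratheodory_measurable => X /=.
rewrite -[leRHS]mul1e.
apply: (le_lebesgue_outer_of_box (nu := fun X =>
  lebesgue_outer (X `&` H) + lebesgue_outer (X `&` ~` H))%E) => //.
- by move=> Y Z YZ; apply: leeD; apply: le_lebesgue_outer; apply: setSI.
- by move=> Y; rewrite adde_ge0 ?lebesgue_outer_ge0.
- move=> F; rewrite !setI_bigcupl.
  rewrite nneseriesD; try by move=> k _ _; exact: lebesgue_outer_ge0.
  by apply: leeD; exact: lebesgue_outer_sigma_subadditive.
move=> [[a b]|]; last by rewrite /= !set0I lebesgue_outer0 adde0 mul1e.
rewrite mul1e.
pose b' : 'rV[R]_n := \row_j if j == i then Num.min (b ord0 i) t else b ord0 j.
pose a' : 'rV[R]_n := \row_j if j == i then Num.max (a ord0 i) t else a ord0 j.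
have bH : box (Some (a, b)) `&` H `<=` box (Some (a, b')).
  move=> x [/= abx xH] j; rewrite !mxE; case: eqP => [->|_]; last exact: abx.
  by rewrite le_min xH andbT; exact: abx.
have bHC : box (Some (a, b)) `&` ~` H `<=` box (Some (a', b)).
  move=> x [/= abx /negP xH] j; rewrite !mxE; case: eqP => [->|_];
    last exact: abx.
  by move: xH; rewrite -ltNge gt_max => ->; rewrite andbT; exact: abx.
apply: le_trans (leeD _ _) _.
- exact: le_trans (le_lebesgue_outer bH) (lebesgue_outer_box_le _).
- exact: le_trans (le_lebesgue_outer bHC) (lebesgue_outer_box_le _).
rewrite /= -EFinD lee_fin le_eqVlt; apply/orP; left; apply/eqP.
apply: (prod_max0_split (i := i)).
- by move=> j /negbTE ji; rewrite !mxE ji.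
- by move=> j /negbTE ji; rewrite !mxE ji.
rewrite !mxE eqxx.
set p := a _ _; set q := b _ _; rewrite /Num.max /Num.min.
by do ![case: ifP]; lra.
Qed.

End outer_measure.

(** * Affine changes of variable *)

Section affine.
Context {R : realType} {n : nat}.
Implicit Types (A X : set 'rV[R]_n) (B : option ('rV[R]_n * 'rV[R]_n)).

(** The volume of a box enlarged by [e] is polynomial in [e]; continuity at 0 removes the
    enlargement. *)
Lemma lee_horner0 (x : \bar R) (p : {poly R}) : (0 <= x)%E ->
  (forall e, 0 < e -> (x <= (p.[e])%:E)%E) -> (x <= (p.[0])%:E)%E.
Proof.
move=> x0 xp; have xfin : x \is a fin_num.
  by rewrite ge0_fin_numE// (le_lt_trans (xp _ ltr01))// ltry.
rewrite -(fineK xfin) lee_fin.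
have p0 : p.[e] @[e --> 0^'+] --> p.[0].
  by apply: cvg_at_right_filter; exact: continuous_horner.
rewrite -(cvg_lim _ p0)//; apply: limr_ge; first by apply/cvg_ex; exists p.[0].
near=> e; rewrite -lee_fin fineK//; apply: xp.
by near: e; exact: nbhs_right_gt.
Unshelve. all: by end_near. Qed.

(* The preimage of a half-open box under a map reversing orientation is
   half-open on the wrong side, hence the enlargement by [e]. *)
Lemma lebesgue_outer_preimage_affine_le (c : R) (v : 'rV[R]_n) A : c != 0 ->
  (lebesgue_outer [set y | A (c *: y + v)%R] <=
   (`|c|^-1 ^+ n)%:E * lebesgue_outer A)%E.
Proof.
move=> c0; pose nu (A : set 'rV[R]_n) := lebesgue_outer [set y | A (c *: y +
  v)%R].
apply: (le_lebesgue_outer_of_box (nu := nu)).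
- by rewrite exprn_ge0// invr_ge0.
- by move=> X Y XY; apply: le_lebesgue_outer => y /=; exact: XY.
- by move=> X; exact: lebesgue_outer_ge0.
- by move=> F; exact: lebesgue_outer_sigma_subadditive.
move=> [[a b]|]; last by rewrite /= mule0 /nu/= lebesgue_outer0.
have [/forallP ab|/forallPn[i /= ba]] := boolP [forall i, a ord0 i < b ord0 i];
    last first.
  rewrite /nu (_ : [set y | _] = set0) ?lebesgue_outer0; last first.
    rewrite -subset0 => y /= /(_ i) /andP[+ /(lt_le_trans _)] =>
      /[swap] /[apply].
    by rewrite (negbTE ba).
  apply: mule_ge0; last exact: (box_volume_ge0 (Some (a, b))).
  by rewrite lee_fin exprn_ge0// invr_ge0.
pose p : {poly R} := \prod_i ('X + (`|c|^-1 * (b ord0 i - a ord0 i))%:P).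
have -> : ((`|c|^-1 ^+ n)%:E * box_volume (Some (a, b)))%E = (p.[0])%:E.
  rewrite /= -EFinM /p horner_prod; congr (_%:E).
  rewrite -[X in _ ^+ X](card_ord n) -prodr_const -big_split/=.
  apply: eq_bigr => i _; rewrite !hornerE/=; congr (_ * _).
  by rewrite max_r// subr_ge0 ltW.
apply: lee_horner0; first exact: lebesgue_outer_ge0.
move=> e e0; pose u i := (a ord0 i - v ord0 i) / c.
pose w i := (b ord0 i - v ord0 i) / c.
have uw i : Num.max (u i) (w i) - Num.min (u i) (w i) =
    `|c|^-1 * (b ord0 i - a ord0 i).
  rewrite -(gtr0_norm (_ : 0 < b ord0 i - a ord0 i)) ?subr_gt0//.
  have -> : b ord0 i - a ord0 i = c * (w i - u i) by rewrite /u /w; field.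
  rewrite normrM mulKf ?normr_eq0//.
  case: (leP (u i) (w i)) => h.
    by rewrite ger0_norm ?subr_ge0.
  by rewrite ltr0_norm ?subr_lt0// opprB.
apply: (@le_trans _ _ (box_volume (Some
  (\row_i (Num.min (u i) (w i) - e), \row_i Num.max (u i) (w i))))); last first.
  rewrite /= lee_fin /p horner_prod; apply: ler_prod => i _; rewrite !mxE.
  rewrite le_max lexx/= !hornerE/= ge_max opprB addrCA uw lexx andbT.
  by rewrite addr_ge0 1?ltW// mulr_gt0 ?invr_gt0 ?normr_gt0// subr_gt0.
apply: le_trans (lebesgue_outer_box_le _); apply: le_lebesgue_outer => y /=.
move=> + i => /(_ i); rewrite !mxE => /andP[ay yb].
have yE : y ord0 i = (c * y ord0 i + v ord0 i - v ord0 i) / c by field.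
set t := c * _ + _ in ay yb yE; rewrite {}yE.
set t' := (t - v ord0 i) / c; rewrite ltrBlDr gt_min le_max.
case: (ltrP 0 c) => [c_gt0|]; last first.
  rewrite le_eqVlt (negbTE c0)/= => c_lt0.
  have w_t' : w i <= t' by rewrite /w /t' ler_nM2r ?invr_lt0// lerB.
  have t'_u : t' <= u i by rewrite /u /t' ler_nM2r ?invr_lt0// lerB// ltW.
  by rewrite t'_u (le_lt_trans w_t') ?ltrDl// orbT.
have u_t' : u i <= t' by rewrite /u /t' ler_pM2r ?invr_gt0// lerB// ltW.
have t'_w : t' <= w i by rewrite /w /t' ler_pM2r ?invr_gt0// lerB.
by rewrite t'_w (le_lt_trans u_t') ?ltrDl// orbT.
Qed.

(** The one-sided affine bound, used for the map and for its inverse, becomes an equality. *)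
Lemma lebesgue_outer_preimage_translation (v : 'rV[R]_n) A :
  lebesgue_outer [set y | A (y + v)] = lebesgue_outer A.
Proof.
have le1 w X : (lebesgue_outer [set y | X (y + w)%R] <= lebesgue_outer X)%E.
  have := @lebesgue_outer_preimage_affine_le 1 w X (oner_neq0 _).
  rewrite normr1 invr1 expr1n mul1e.
  by under eq_set do rewrite scale1r.
apply/eqP; rewrite eq_le le1/=.
have := le1 (- v) [set y | A (y + v)].
by rewrite /=; under eq_set do rewrite subrK.
Qed.

Lemma lebesgue_outer_preimage_reflection (v : 'rV[R]_n) A :
  lebesgue_outer [set y | A (v - y)] = lebesgue_outer A.
Proof.
have le1 X : (lebesgue_outer [set y | X (v - y)%R] <= lebesgue_outer X)%E.
  have := @lebesgue_outer_preimage_affine_le (-1) v X.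
  rewrite oppr_eq0 oner_neq0 normrN1 invr1 expr1n mul1e => /(_ isT).
  by under eq_set do rewrite scaleN1r addrC.
apply/eqP; rewrite eq_le le1/=.
have := le1 [set y | A (v - y)].
by rewrite /=; under eq_set do rewrite subKr.
Qed.

Lemma lebesgue_measurableP A : lebesgue_measurable A <->
  forall X, lebesgue_outer X =
    (lebesgue_outer (X `&` A) + lebesgue_outer (X `&` ~` A))%E.
Proof. by []. Qed.

Lemma lebesgue_measurable_preimage_translation (v : 'rV[R]_n) A :
  lebesgue_measurable A -> lebesgue_measurable [set y | A (y + v)].
Proof.
move=> /lebesgue_measurableP mA; apply/lebesgue_measurableP => X.
rewrite -(lebesgue_outer_preimage_translation (- v) X) [LHS]mA.
by congr (_ + _)%E; rewrite -[RHS](lebesgue_outer_preimage_translation (- v));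
  congr lebesgue_outer; apply/seteqP; split => y /=; rewrite subrK.
Qed.

Lemma lebesgue_measurable_preimage_reflection (v : 'rV[R]_n) A :
  lebesgue_measurable A -> lebesgue_measurable [set y | A (v - y)].
Proof.
move=> /lebesgue_measurableP mA; apply/lebesgue_measurableP => X.
rewrite -(lebesgue_outer_preimage_reflection v X) [LHS]mA.
by congr (_ + _)%E; rewrite -[RHS](lebesgue_outer_preimage_reflection v);
  congr lebesgue_outer; apply/seteqP; split => y /=; rewrite subKr.
Qed.

End affine.

(** * Measurability, sigma-finiteness and integration under reflections *)

Section measurability.
Context {R : realType} {n : nat}.
Local Notation T := (caratheodory_type (@lebesgue_outer R n)).
Implicit Types (A X : set 'rV[R]_n).

Lemma measurable_coord (i : 'I_n) :
  measurable_fun [set: T] (fun x : T => (x : 'rV[R]_n) ord0 i).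
Proof.
apply: (measurability _ (measurable_realfun.RGenOInfty.measurableE R)) =>
  _ [_ [a ->] <-].
rewrite setTI.
have -> : (fun x : T => (x : 'rV[R]_n) ord0 i) @^-1` `]a, +oo[ =
    ~` [set x : 'rV[R]_n | x ord0 i <= a].
  apply/seteqP; split => x /=; rewrite in_itv/= andbT ltNge; first by move/negP.
  by move/negP.
by apply: (@measurableC _ T); exact: lebesgue_measurable_halfspace.
Qed.

Lemma measurable_enormB d (X : measurableType d) (f g : X -> T) :
  measurable_fun setT f -> measurable_fun setT g ->
  measurable_fun setT (fun x => enorm ((f x : 'rV[R]_n) - g x)).
Proof.
move=> mf mg; apply: measurableT_comp => /=.
  exact: continuous_measurable_fun (@sqrt_continuous R).
apply: measurable_sum => i; apply: measurable_funX.
under eq_fun do rewrite !mxE.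
by apply: measurable_funB; exact: measurableT_comp (measurable_coord i) _.
Qed.

Lemma measurable_frac_kernel s d (X : measurableType d) (f g : X -> T) :
  measurable_fun setT f -> measurable_fun setT g ->
  measurable_fun setT (fun x => frac_kernel s (f x : 'rV[R]_n) (g x)).
Proof.
move=> mf mg.
rewrite (_ : (fun x => _) =
    (@powR R ^~ (- (n%:R + s))) \o (fun x => enorm ((f x : 'rV[R]_n) - g x))).
  exact: (measurableT_comp (measurable_powR (- (n%:R + s)))
    (measurable_enormB mf mg)).
by apply/funext => x; rewrite /frac_kernel /= powRN.
Qed.

Lemma lebesgue_measurable_eball (c : 'rV[R]_n) r : lebesgue_measurable (eball c
  r).
Proof.
have := measurable_fun_ltr (measurable_enormB (@measurable_id _ T setT)
   (@measurable_cst _ _ T T setT c)) (@measurable_cst _ _ T R setT r).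
move=> /(_ measurableT [set true]); rewrite setTI => /(_ I).
congr (_ _); apply/seteqP; split => y //=.
Qed.

Lemma lebesgue_cube_le A (k : R) : 0 <= k ->
  A `<=` [set x : 'rV[R]_n | forall i, - k < x ord0 i <= k] ->
  (lebesgue_outer A <= ((2 * k) ^+ n)%:E)%E.
Proof.
move=> k0 Ak; pose B : option ('rV[R]_n * 'rV[R]_n) :=
  Some (\row__ (- k), \row__ k).
have AB : A `<=` box B by move=> x /Ak Ax i; rewrite !mxE; exact: Ax.
apply: (le_trans (le_lebesgue_outer AB));
  apply: le_trans (lebesgue_outer_box_le _) _.
rewrite /= lee_fin -[X in _ ^+ X](card_ord n) -prodr_const.
rewrite le_eqVlt; apply/orP; left; apply/eqP; apply: eq_bigr => i _.
by rewrite !mxE opprK max_r ?addr_ge0// mulr_natl mulr2n.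
Qed.

(** Tonelli's theorem, behind [integral_swap], relies on this property. *)
Lemma lebesgue_sigma_finite : sigma_finite [set: T] (@lebesgue R n).
Proof.
pose B k : set 'rV[R]_n := [set x | forall i, - k%:R < x ord0 i <= k%:R].
have mB k : lebesgue_measurable (B k).
  have -> : B k = \bigcap_(i in [set: 'I_n])
     (~` [set x : 'rV[R]_n | x ord0 i <= - k%:R] `&` [set x | x ord0 i <=
       k%:R]).
    apply/seteqP; split => x /= Bx.
      by move=> i _; have /andP[+ ?] := Bx i; split => //=; apply/negP;
        rewrite -ltNge.
    by move=> i; have [//|+ ->] := Bx i; move/negP; rewrite -ltNge => ->.
  apply: (@fin_bigcap_measurable _ T) => // i _.
  apply: (@measurableI _ T); last exact: lebesgue_measurable_halfspace.
  by apply: (@measurableC _ T); exact: lebesgue_measurable_halfspace.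
exists B.
  apply/seteqP; split => // x _;
    pose M := \sum_(i < n) `|(x : 'rV[R]_n) ord0 i|.
  have xM i : `|(x : 'rV[R]_n) ord0 i| <= M.
    by rewrite /M (bigD1 i)//= lerDl sumr_ge0.
  exists (Num.truncn M).+1 => //= i.
  have MM := truncnS_gt M; have := le_lt_trans (xM i) MM.
  by rewrite ltr_norml => /andP[-> /ltW->].
move=> k; split; first exact: mB.
exact: le_lt_trans (lebesgue_cube_le (ler0n R k) (@subset_refl _ _)) (ltry _).
Qed.

HB.instance Definition _ :=
  Measure_isSigmaFinite.Build _ _ _ (@lebesgue R n) lebesgue_sigma_finite.

(** The measure is its own pushforward under y -> v - y. With [v = z + z] this is the point
    reflection about [z]. *)
Lemma ge0_integral_reflection (v : 'rV[R]_n) (D : set T) (f : T -> \bar R) :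
  measurable D -> measurable_fun D f -> (forall y, D y -> (0 <= f y)%E) ->
  (\int[lebesgue]_(y in D) f y =
   \int[lebesgue]_(y in [set y : T | D (v - (y : 'rV[R]_n))%R])
     f (v - (y : 'rV[R]_n))%R)%E.
Proof.
move=> mD mf f0; pose rho (y : T) : T := (v - (y : 'rV[R]_n))%R.
have mrho : measurable_fun setT rho.
  move=> _ Y mY; rewrite setTI.
  exact: lebesgue_measurable_preimage_reflection mY.
have := @ge0_integral_pushforward _ _ _ _ _ _ mrho (@lebesgue R n) D f mD mf.
move=> /(_ _)/= <-; last by move=> y; rewrite inE; exact: f0.
apply: eq_measure_integral => Y mY _.
by rewrite /pushforward; exact/esym/(lebesgue_outer_preimage_reflection v Y).
Qed.

End measurability.

(** * The Euclidean norm *)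

Section euclidean.
Context {R : realType} {n : nat}.
Implicit Types (x y z w c : 'rV[R]_n).

Definition dotrv x y : R := \sum_(i < n) x ord0 i * y ord0 i.

Lemma enorm_ge0 x : 0 <= enorm x.
Proof. exact: sqrtr_ge0. Qed.

Lemma enorm_sqr x : enorm x ^+ 2 = dotrv x x.
Proof.
by rewrite sqr_sqrtr ?sumr_ge0// => i _; rewrite sqr_ge0.
Qed.

Lemma enormN x : enorm (- x) = enorm x.
Proof. by congr Num.sqrt; apply: eq_bigr => i _; rewrite mxE sqrrN. Qed.

Lemma enormBC x y : enorm (x - y) = enorm (y - x).
Proof. by rewrite -opprB enormN. Qed.

Lemma coord_le_enorm x i : `|x ord0 i| <= enorm x.
Proof.
rewrite -sqrtr_sqr; apply: ler_wsqrtr.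
by rewrite (bigD1 i)//= lerDl sumr_ge0// => j _; rewrite sqr_ge0.
Qed.

Lemma dotrv_linear (a b : R) x y z :
  dotrv (a *: x + b *: y) z = a * dotrv x z + b * dotrv y z.
Proof.
rewrite /dotrv !mulr_sumr -big_split/=; apply: eq_bigr => i _.
by rewrite !mxE; ring.
Qed.

Lemma dotrvC x y : dotrv x y = dotrv y x.
Proof. by apply: eq_bigr => i _; rewrite mulrC. Qed.

Lemma enorm_sqr_lin (a b : R) x y : enorm (a *: x + b *: y) ^+ 2 =
  a ^+ 2 * enorm x ^+ 2 + 2 * a * b * dotrv x y + b ^+ 2 * enorm y ^+ 2.
Proof.
rewrite !enorm_sqr dotrv_linear [dotrv x _]dotrvC [dotrv y _]dotrvC.
by rewrite !dotrv_linear [dotrv y x]dotrvC; ring.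
Qed.

(** Cauchy-Schwarz, from expanding the square of |y| x - |x| y and dividing by 2 |x| |y|; hence the
    separate cases of norm 0. *)
Lemma dotrv_le x y : dotrv x y <= enorm x * enorm y.
Proof.
have [x0|x0] := eqVneq (enorm x) 0.
  rewrite x0 mul0r /dotrv big1// => i _.
  have := coord_le_enorm x i; rewrite x0 normr_le0 => /eqP->.
  by rewrite mul0r.
have [y0|y0] := eqVneq (enorm y) 0.
  rewrite y0 mulr0 /dotrv big1// => i _.
  have := coord_le_enorm y i; rewrite y0 normr_le0 => /eqP->.
  by rewrite mulr0.
have xy : 0 < 2 * (enorm x * enorm y).
  by rewrite mulr_gt0// mulr_gt0// lt0r ?x0 ?y0 enorm_ge0.
have := sqr_ge0 (enorm (enorm y *: x + (- enorm x) *: y)).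
rewrite enorm_sqr_lin (_ : _ + _ =
  2 * (enorm x * enorm y) * (enorm x * enorm y - dotrv x y)); last by ring.
by rewrite pmulr_rge0// subr_ge0.
Qed.

Lemma enormD x y : enorm (x + y) <= enorm x + enorm y.
Proof.
rewrite -(@ler_pXn2r _ 2)// ?nnegrE ?addr_ge0 ?enorm_ge0//.
have := enorm_sqr_lin 1 1 x y; rewrite !scale1r => ->.
have := dotrv_le x y; rewrite sqrrD; lra.
Qed.

Lemma enormB_triangle z x y : enorm (x - y) <= enorm (x - z) + enorm (z - y).
Proof. by apply: le_trans (enormD _ _); rewrite addrA subrK. Qed.

(** The n squares are below (e / (n+1))^2 and n < (n+1)^2; the successor also covers n = 0. This is
    the passage from sup-norm balls to Euclidean ones. *)
Lemma enorm_lt_of_coord (e : R) x : 0 < e ->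
  (forall i, `|x ord0 i| < e / n.+1%:R) -> enorm x < e.
Proof.
move=> e0 xe; rewrite -(@ltr_pXn2r _ 2)// ?nnegrE ?enorm_ge0 ?ltW//.
rewrite enorm_sqr; apply: (@le_lt_trans _ _ (\sum_(i < n) (e / n.+1%:R) ^+ 2)).
  apply: ler_sum => i _; rewrite -expr2 -real_normK ?num_real//.
  by rewrite ler_pXn2r ?nnegrE ?divr_ge0 ?(ltW e0)// ltW.
rewrite sumr_const card_ord -[X in X < _]mulr_natl expr_div_n mulrA ltr_pdivrMr
  ?exprn_gt0//.
rewrite mulrC ltr_pM2l ?exprn_gt0// -natrX ltr_nat.
by rewrite (leq_trans (ltnSn n))// -{1}[n.+1]expn1 leq_pexp2l.
Qed.

Lemma nbhs_eball x (e : R) : 0 < e -> nbhs x (eball x e).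
Proof.
move=> e0; apply/nbhs_ballP; exists (e / n.+1%:R) => /=;
  first by rewrite divr_gt0.
move=> y xy; rewrite /eball/= enormBC; apply: enorm_lt_of_coord => // i.
by rewrite !mxE; exact: (xy.2 ord0 i).
Qed.

Lemma open_eball_subset (Omega : set 'rV[R]_n) x : open Omega -> Omega x ->
  exists2 e : R, 0 < e & eball x e `<=` Omega.
Proof.
move=> oO Ox; have /nbhs_ballP[e /= e0 eO] := open_nbhs_nbhs (conj oO Ox).
exists e => // y; rewrite /eball/= enormBC => xy; apply: eO; split=> //= i j.
apply: le_lt_trans xy; have := coord_le_enorm (x - y) j.
by rewrite !mxE (ord1 i).
Qed.

(** The bound gives phi <= r^2 at [x], and [x != c] makes the gradient 2 (x - c) of phi at [x]
    nonzero. *)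
Lemma boundary_eball c x (r : R) : 0 < r -> boundary (eball c r) x ->
  enorm (x - c) <= r /\ x != c.
Proof.
move=> r0 [clx intx]; split.
  apply/ler_addgt0Pr => e e0.
  have [y [cy xy]] := clx _ (nbhs_eball x e0).
  apply: le_trans (enormB_triangle y x c) _; rewrite addrC.
  by apply: ltW; rewrite ltrD// enormBC.
by apply/eqP => xc; apply: intx; rewrite xc; exact: nbhs_eball.
Qed.

Lemma exists_coord_neq0 x : x != 0 -> exists i, x ord0 i != 0.
Proof.
move=> x0; have [/existsP//|/existsPn h] := boolP [exists i, x ord0 i != 0].
case/negP: x0; apply/eqP/rowP => i; rewrite mxE.
by have := h i; rewrite negbK => /eqP.
Qed.

Lemma enormZ (a : R) x : enorm (a *: x) = `|a| * enorm x.
Proof.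
apply/eqP; rewrite -(@eqrXn2 _ 2)// ?mulr_ge0 ?enorm_ge0//.
have := enorm_sqr_lin a 0 x 0; rewrite scaler0 addr0 => ->.
by rewrite exprMn real_normK ?num_real//; apply/eqP; ring.
Qed.

End euclidean.

(** * Integrals of the fractional kernel *)

Section dyadic.
Local Open Scope ereal_scope.
Context d (T : measurableType d) (R : realType) (mu : {measure set T -> \bar
  R}).

(** Summation of a geometric series over disjoint pieces. The alternative [f x = 0] takes care of
    the pole of the kernel, which lies in no annulus and where [frac_kernel] has the value 0 by
    convention. *)
Lemma ge0_integral_dyadic_le (F : (set T)^nat) (D : set T) (f : T -> \bar R)
    (C q : R) :
  measurable D -> (forall k, measurable (F k)) -> trivIset setT F ->
  measurable_fun setT f -> (forall x, 0 <= f x) ->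
  (forall x, D x -> f x = 0 \/ exists k, F k x) ->
  (0 <= C)%R -> (0 < q < 1)%R ->
  (forall k, \int[mu]_(x in F k) f x <= (C * q ^+ k)%:E) ->
  \int[mu]_(x in D) f x <= (C / (1 - q))%:E.
Proof.
move=> mD mF tF mf f0 DF C0 /andP[q0 q1] FC.
have mU : measurable (\bigcup_k F k) by exact: bigcup_measurable.
apply: (@le_trans _ _ (\int[mu]_(x in \bigcup_k F k) f x)).
  rewrite integral_mkcond [leRHS]integral_mkcond; apply: ge0_le_integral => //.
  - by move=> x _; apply: erestrict_ge0.
  - by apply/(measurable_restrictT _ mD); exact: measurable_funTS.
  - by apply/(measurable_restrictT _ mU); exact: measurable_funTS.
  move=> x _; rewrite /patch; case: ifPn => [|_]; last by case: ifP.
  rewrite inE => /DF[->|Fx]; first by case: ifP.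
  by rewrite ifT// inE; have [k] := Fx; exists k.
rewrite ge0_integral_bigcup//; last exact: measurable_funTS.
apply: lime_le; first by apply: is_cvg_nneseries => k _ _; exact: integral_ge0.
apply: nearW => k; apply: (@le_trans _ _ (\sum_(0 <= i < k) (C * q ^+ i)%:E)).
  by apply: lee_sum => i _; exact: FC.
rewrite sumEFin lee_fin; apply: geometric_le_lim => //.
by rewrite gtr0_norm.
Qed.

End dyadic.

Section kernel_bounds.
Context {R : realType} {n : nat}.
Local Notation T := (caratheodory_type (@lebesgue_outer R n)).
Implicit Types (x y z w p : 'rV[R]_n) (s rho delta : R).

Lemma frac_kernel_ge0 s x y : 0 <= frac_kernel s x y.
Proof. by rewrite /frac_kernel invr_ge0 powR_ge0. Qed.

Lemma frac_kernelC s x y : frac_kernel s x y = frac_kernel s y x.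
Proof. by rewrite /frac_kernel enormBC. Qed.

Lemma frac_kernel_le s rho x y : 0 < s -> 0 < rho -> rho <= enorm (x - y) ->
  frac_kernel s x y <= (rho `^ (n%:R + s))^-1.
Proof.
move=> s0 rho0 rhoxy.
rewrite /frac_kernel lef_pV2 ?posrE ?powR_gt0// ?(lt_le_trans rho0)//.
apply: ge0_ler_powR => //; first by rewrite addr_ge0// ltW.
- by rewrite nnegrE ltW.
- by rewrite nnegrE enorm_ge0.
Qed.

Lemma measurable_frac_kernelr s x :
  measurable_fun [set: T] (fun y : T => frac_kernel s x (y : 'rV[R]_n)).
Proof.
exact: (measurable_frac_kernel s (@measurable_cst _ _ T T setT x)
  (@measurable_id _ T setT)).
Qed.

Lemma integral_kernel_le s rho x (V : R) (S : set T) : 0 < s -> 0 < rho ->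
  measurable S -> S `<=` [set y | rho <= enorm (x - y)] ->
  (lebesgue S <= V%:E)%E ->
  (\int[lebesgue]_(y in S) (frac_kernel s x y)%:E <=
   ((rho `^ (n%:R + s))^-1 * V)%:E)%E.
Proof.
move=> s0 rho0 mS Srho SV.
apply: (@le_trans _ _ (\int[lebesgue]_(y in S) (cst ((rho `^ (n%:R +
  s))^-1)%:E y))%E).
  apply: ge0_le_integral; first exact: mS.
  - by move=> y _; rewrite lee_fin frac_kernel_ge0.
  - apply/measurable_EFinP; apply: measurable_funTS.
    exact: measurable_frac_kernelr.
  - exact: measurable_cst.
  - by move=> y Sy; rewrite lee_fin frac_kernel_le//; exact: Srho.
rewrite integral_cst// EFinM lee_pmul2l// lte_fin invr_gt0 powR_gt0//.
Qed.

(* The translates of [S] along the [i]-th axis by multiples of [h] are disjoint,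
   and at least [rho / h] of them lie in a cube of side [6 * rho]. *)
Lemma slab_volume_le (i : 'I_n) (m rho : R) p z (S : set T) :
  0 < m -> m <= `|p ord0 i| -> 0 < rho -> measurable S ->
  S `<=` [set y | enorm ((y : 'rV[R]_n) - z) <= rho /\
                  `|dotrv p ((y : 'rV[R]_n) - z)| <= 2 * rho ^+ 2] ->
  (lebesgue S <= ((6 * rho) ^+ n * (5 * rho / m))%:E)%E.
Proof.
(* Two points of the slab have scalar products with [p] differing by at most 4 rho^2, whereas a
   shift by [h] along the axis changes the product by at least h m = 5 rho^2: this makes the
   translates disjoint. *)
move=> m0 mp rho0 mS Sslab; pose h := 5 * rho ^+ 2 / m.
have h0 : 0 < h by rewrite divr_gt0// mulr_gt0// exprn_gt0.
pose v k : 'rV[R]_n := z - (k%:R * h) *: delta_mx ord0 i.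
pose F k : set T := [set y | S ((y : 'rV[R]_n) + v k)].
have mF k : measurable (F k) by exact: lebesgue_measurable_preimage_translation.
have lF k : lebesgue (F k) = lebesgue S.
  exact: lebesgue_outer_preimage_translation.
have vE l y : (y : 'rV[R]_n) + v l - z =
    1 *: y + (- (l%:R * h)) *: delta_mx ord0 i.
  by apply/rowP => j; rewrite !mxE; ring.
have pE : dotrv (delta_mx ord0 i) p = p ord0 i.
  rewrite /dotrv (bigD1 i)//= big1 ?addr0 => [|l li].
    by rewrite mxE !eqxx mul1r.
  by rewrite mxE (negbTE li) andbF mul0r.
have disjF j k : (j < k)%N -> F j `&` F k = set0.
  move=> jk; rewrite -subset0 => y [/Sslab[_ yj] /Sslab[_ yk]].
  move: yj yk; rewrite ![dotrv p _]dotrvC !vE !dotrv_linear pE => yj yk.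
  have := le_trans (ler_normB _ _) (lerD yj yk).
  rewrite (_ : _ - _ = (k - j)%:R * h * p ord0 i); last first.
    by rewrite natrB 1?ltnW//; ring.
  rewrite 2!normrM (gtr0_norm h0) normr_nat.
  apply/negP; rewrite -ltNge.
  have kj1 : 1 <= (k - j)%:R :> R by rewrite ler1n subn_gt0.
  apply: (@lt_le_trans _ _ (1 * h * m)); last first.
    apply: ler_pM => //; [by rewrite mul1r ltW|exact: ltW|].
    by rewrite ler_wpM2r// ltW.
  rewrite /h mul1r divfK ?gt_eqF//.
  have := exprn_gt0 2 rho0; lra.
have tF : trivIset setT F.
  apply/trivIsetP => j k _ _; rewrite neq_ltn => /orP[/disjF//|/disjF].
  by rewrite setIC.
(* [N] exceeds rho / h, yet every index k < N satisfies k h <= rho, which keeps the translates in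
   the cube of half-side 3 rho. *)
pose N := (Num.truncn (rho / h)).+1.
have Nrho : rho / h < N%:R by exact: truncnS_gt.
have cube : (lebesgue (\big[setU/set0]_(k < N) F k) <= ((6 * rho) ^+ n)%:E)%E.
  have -> : 6 * rho = 2 * (3 * rho) by ring.
  apply: lebesgue_cube_le; first by rewrite mulr_ge0// ltW.
  rewrite -bigcup_mkord => y [k /= kN /Sslab[yk _]] l.
  have kh : k%:R * h <= rho.
    rewrite -ler_pdivlMr//.
    have : k%:R <= (Num.truncn (rho / h))%:R :> R by rewrite ler_nat.
    by move/le_trans; apply; rewrite truncn_le divr_ge0// ltW.
  have := le_trans (coord_le_enorm _ l) yk.
  rewrite vE !mxE mul1r eqxx/= ler_norml => /andP[].
  have kh0 : 0 <= k%:R * h by rewrite mulr_ge0// ltW.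
  by case: (l == i) => /=; lra.
move: cube; rewrite measure_bigsetU// (eq_bigr (fun=> lebesgue S)); last first.
  by move=> k _; exact: lF.
move=> cube.
have Sfin : lebesgue S \is a fin_num.
  rewrite ge0_fin_numE//; apply: le_lt_trans (ltry ((6 * rho) ^+ n)).
  apply: le_trans cube; rewrite big_ord_recl leeDl// sume_ge0//.
move: cube; rewrite -(fineK Sfin) sumEFin sumr_const card_ord !lee_fin => cube.
have rh : rho / h * (5 * rho / m) = 1.
  by rewrite /h; field; rewrite !gt_eqF.
have h1 : 0 < 5 * rho / m by rewrite divr_gt0// mulr_gt0.
rewrite (_ : fine _ = fine (lebesgue S) * (rho / h) * (5 * rho / m));
  last first.
  by rewrite -mulrA rh mulr1.
rewrite ler_pM2r//; apply: le_trans cube.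
by rewrite -[leRHS]mulr_natr ler_wpM2l ?fine_ge0// ltW.
Qed.

(** Volume times kernel at scale rho: [k = n + 1] gives the slab exponent 1 - s, and [k = n] the
    exponent -s of a full annulus. *)
Lemma exprn_invr_powR rho s (k : nat) : 0 < rho ->
  rho ^+ k * (rho `^ (n%:R + s))^-1 = rho `^ (k%:R - n%:R - s).
Proof.
move=> rho0; rewrite -powR_mulrn ?ltW// -powRN -powRD ?(gt_eqF rho0) ?implybT//.
by congr (_ `^ _); ring.
Qed.

Lemma powR_exprn (a r : R) (k : nat) : 0 <= a -> (a ^+ k) `^ r = (a `^ r) ^+ k.
Proof.
by move=> a0; rewrite -powR_mulrn// -powRrM mulrC powRrM powR_mulrn ?powR_ge0.
Qed.

Lemma dyadic_shrink (t delta : R) : 0 < t < delta ->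
  exists k, delta * 2^-1 ^+ k.+1 <= t < delta * 2^-1 ^+ k.
Proof.
move=> /andP[t0 td].
have : exists k, delta * 2^-1 ^+ k.+1 <= t.
  exists (Num.truncn (delta / t)).+1; set k := _.+1.
  rewrite exprVn ler_pdivrMr ?exprn_gt0// mulrC -ler_pdivrMr//.
  apply: ltW; apply: lt_trans (truncnS_gt _) _.
  by rewrite -natrX ltr_nat (ltn_trans (ltn_expl _ (ltnSn 1)))// ltn_exp2l.
move=> /ex_minnP[[|k] kt kmin]; first by exists 0%N; rewrite kt expr0 mulr1.
exists k.+1; rewrite kt ltNge/=; apply/negP => /kmin.
by rewrite ltnn.
Qed.

Lemma dyadic_grow (t delta : R) : 0 < delta <= t ->
  exists k, delta * 2 ^+ k <= t < delta * 2 ^+ k.+1.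
Proof.
move=> /andP[d0 dt].
have : exists k, t < delta * 2 ^+ k.+1.
  exists (Num.truncn (t / delta)); set k := Num.truncn _.
  rewrite mulrC -ltr_pdivrMr//; apply: lt_trans (truncnS_gt _) _.
  by rewrite -natrX ltr_nat ltn_expl.
move=> /ex_minnP[[|k] kt kmin]; first by exists 0%N; rewrite kt expr0 mulr1 dt.
exists k.+1; rewrite kt andbT leNgt; apply/negP => /kmin.
by rewrite ltnn.
Qed.

Lemma measurable_ltr_set d (X : measurableType d) (f g : X -> R) :
  measurable_fun setT f -> measurable_fun setT g -> measurable [set x | f x < g
    x].
Proof.
move=> mf mg; have := measurable_fun_ltr mf mg;
  move=> /(_ measurableT [set true]).
by rewrite setTI => /(_ I).
Qed.

Lemma measurable_ler_set d (X : measurableType d) (f g : X -> R) :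
  measurable_fun setT f -> measurable_fun setT g -> measurable [set x | f x <=
    g x].
Proof.
move=> mf mg; have := measurable_fun_ler mf mg;
  move=> /(_ measurableT [set true]).
by rewrite setTI => /(_ I).
Qed.

Lemma measurable_enormBr z :
  measurable_fun [set: T] (fun y : T => enorm (z - (y : 'rV[R]_n))).
Proof.
exact: (measurable_enormB (@measurable_cst _ _ T T setT z)
  (@measurable_id _ T setT)).
Qed.

Lemma measurable_dotrvB p z :
  measurable_fun [set: T] (fun y : T => dotrv p ((y : 'rV[R]_n) - z)).
Proof.
apply: measurable_sum => j; apply: measurable_funM; first exact: measurable_cst.
rewrite (_ : (fun _ => _) = (fun y : T => (y : 'rV[R]_n) ord0 j - z ord0 j)).
  apply: measurable_funB; last exact: measurable_cst.
  exact: measurable_coord.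
by apply/funext => y; rewrite !mxE.
Qed.

Definition annulus z (r1 r2 : R) : set T :=
  [set y | r1 <= enorm (z - (y : 'rV[R]_n)) < r2].

Lemma measurable_annulus z r1 r2 : measurable (annulus z r1 r2).
Proof.
have := measurableI _ _
  (measurable_ler_set (measurable_cst r1) (measurable_enormBr z))
  (measurable_ltr_set (measurable_enormBr z) (measurable_cst r2)).
congr measurable; apply/seteqP; split => y; first by move=> [/= h1 h2];
  apply/andP.
by move=> /andP[].
Qed.

Lemma trivIset_annulus z (u v : nat -> R) :
  (forall j k, (j < k)%N -> v k <= u j \/ v j <= u k) ->
  trivIset setT (fun k => annulus z (u k) (v k)).
Proof.
move=> uv; have disj j k : (j < k)%N ->
    annulus z (u j) (v j) `&` annulus z (u k) (v k) = set0.
  move=> /uv h; rewrite -subset0 => y [/andP[u1 v1] /andP[u2 v2]].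
  case: h; rewrite leNgt => /negP; apply.
    exact: le_lt_trans u1 v2.
  exact: le_lt_trans u2 v1.
apply/trivIsetP => j k _ _; rewrite neq_ltn => /orP[/disj//|/disj].
by rewrite setIC.
Qed.

(** The threshold is the quadratic term in [bumpD]: where the linear term exceeds it in absolute
    value, the linear term decides the sign of phi y - phi z. *)
Definition slab p z delta : set T := [set y |
  enorm (z - (y : 'rV[R]_n)) < delta /\
  `|dotrv p ((y : 'rV[R]_n) - z)| <= 2 * enorm (z - (y : 'rV[R]_n)) ^+ 2].

Lemma measurable_slab p z delta : measurable (slab p z delta).
Proof.
apply: (measurableI _ _
  (measurable_ltr_set (measurable_enormBr z) (measurable_cst delta))
  (measurable_ler_set _ _)).
  by apply: measurableT_comp; last exact: measurable_dotrvB.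
apply: measurable_funM; first exact: measurable_cst.
by apply: measurable_funX; exact: measurable_enormBr.
Qed.

(** Each dyadic piece contributes a multiple of r_k^(1-s), with ratio 2^(s-1) < 1. The constant
    precedes [p], [z] and [delta], so it can be fixed before the scale tau and used at all points of
    A. *)
Lemma slab_kernel_integral_le (i : 'I_n) (m s : R) : 0 < m -> 0 < s < 1 ->
  exists2 C, 0 < C & forall p z delta, m <= `|p ord0 i| -> 0 < delta ->
    (\int[lebesgue]_(y in slab p z delta) (frac_kernel s z y)%:E <=
     (C * delta `^ (1 - s))%:E)%E.
Proof.
move=> m0 /andP[s0 s1]; have s1' : 0 < 1 - s by rewrite subr_gt0.
pose q : R := 2^-1 `^ (1 - s).
have q01 : 0 < q < 1.
  have pow1 : 1 `^ (1 - s) = 1 :> R by rewrite powR1.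
  rewrite powR_gt0//= /q -[ltRHS]pow1.
  by rewrite gt0_ltr_powR// ?nnegrE// invf_lt1// ltr1n.
have /andP[q0 q1] := q01.
(* The first factor is the loss from evaluating the kernel at the inner radius r_k / 2; the others
   come from [slab_volume_le]. *)
pose C0 := 2 `^ (n%:R + s) * 6 ^+ n * 5 / m.
have C00 : 0 < C0.
  by rewrite /C0 divr_gt0// mulr_gt0// mulr_gt0 ?powR_gt0// exprn_gt0.
exists (C0 / (1 - q)); first by rewrite divr_gt0// subr_gt0.
move=> p z delta mp delta0.
pose r k := delta * 2^-1 ^+ k.
have r0 k : 0 < r k by rewrite mulr_gt0// exprn_gt0.
have rS k : r k.+1 = r k / 2 by rewrite /r exprSr mulrA.
pose F k := slab p z delta `&` annulus z (r k.+1) (r k).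
rewrite mulrAC; apply: (ge0_integral_dyadic_le (F := F)).
- exact: measurable_slab.
- by move=> k; apply: measurableI;
  [exact: measurable_slab|exact: measurable_annulus].
- apply: trivIset_setIl; apply: trivIset_annulus => j k jk; left.
  rewrite ler_pM2l//; apply: ler_wiXn2l => //.
  by rewrite invf_le1// ler1n.
- by apply/measurable_EFinP; exact: measurable_frac_kernelr.
- by move=> y; rewrite lee_fin frac_kernel_ge0.
- move=> y slaby; have [zy|] := eqVneq (enorm (z - (y : 'rV[R]_n))) 0.
    left; rewrite /frac_kernel zy powR0 ?invr0//.
    by rewrite gt_eqF// ltr_wpDl.
  rewrite neq_lt ltNge enorm_ge0/= => zy; right.
  have [|k kzy] := @dyadic_shrink (enorm (z - (y : 'rV[R]_n))) delta.
    by rewrite zy; exact: slaby.1.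
  by exists k; split.
- by rewrite mulr_ge0// ?powR_ge0// ltW.
- exact: q01.
move=> k; have Fk : (lebesgue (F k) <= ((6 * r k) ^+ n * (5 * r k / m))%:E)%E.
  apply: (@slab_volume_le i m (r k) p z) => //.
    by apply: measurableI; [exact: measurable_slab|exact: measurable_annulus].
  move=> y [[_ slaby] /andP[_ yr]]; split; first by rewrite enormBC ltW.
  apply: le_trans slaby _;
    rewrite ler_pM2l// ler_pXn2r ?nnegrE ?enorm_ge0// ltW//.
have mF : measurable (F k).
  by apply: measurableI; [exact: measurable_slab|exact: measurable_annulus].
apply: le_trans (integral_kernel_le s0 (r0 k.+1) mF _ Fk) _.
  by move=> y [_ /andP[]].
rewrite lee_fin le_eqVlt; apply/orP; left; apply/eqP.
have := exprn_invr_powR s n.+1 (r0 k).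
rewrite (_ : _ - _ - s = 1 - s); last by rewrite -addn1 natrD; ring.
have -> : r k `^ (1 - s) = delta `^ (1 - s) * q ^+ k.
  by rewrite powRM ?exprn_ge0 ?ltW// powR_exprn.
have half : 2^-1 `^ (n%:R + s) = (2 `^ (n%:R + s))^-1 :> R.
  by rewrite -powR_inv1// -powRrM mulN1r powRN.
rewrite rS powRM ?invr_ge0 ?ltW// half invfM invrK => rk.
rewrite -[in RHS]mulrA -rk /C0 exprMn exprS.
by field; rewrite !gt_eqF ?powR_gt0.
Qed.

(** Annuli of radii delta 2^k have volume at most (4 r_k)^n, so their contributions decrease
    geometrically with ratio 2^(-s). *)
Lemma far_kernel_integral_lty s x delta : 0 < s -> 0 < delta ->
  (\int[lebesgue]_(y in [set y : T | (delta <= enorm (x - (y : 'rV[R]_n)))%R])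
     (frac_kernel s x y)%:E < +oo)%E.
Proof.
move=> s0 delta0; pose q : R := 2 `^ (- s).
have q01 : 0 < q < 1.
  rewrite powR_gt0//= /q powRN invf_lt1 ?powR_gt0//.
  have pow1 : 1 `^ s = 1 :> R by rewrite powR1.
  by rewrite -[ltLHS]pow1 gt0_ltr_powR// ?nnegrE// ltr1n.
have /andP[q0 q1] := q01.
pose C := 4 ^+ n * delta `^ (- s).
pose r k := delta * 2 ^+ k.
have r0 k : 0 < r k by rewrite mulr_gt0// exprn_gt0.
apply: le_lt_trans (ltry (C / (1 - q))).
apply: (ge0_integral_dyadic_le (F := fun k => annulus x (r k) (r k.+1))).
- exact: (measurable_ler_set (measurable_cst delta) (measurable_enormBr x)).
- by move=> k; exact: measurable_annulus.
- apply: trivIset_annulus => j k jk; right.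
  by rewrite ler_pM2l//; apply: ler_weXn2l => //; rewrite ler1n.
- by apply/measurable_EFinP; exact: measurable_frac_kernelr.
- by move=> y; rewrite lee_fin frac_kernel_ge0.
- move=> y /= xy; right.
  by have [|k kxy] := @dyadic_grow (enorm (x - (y : 'rV[R]_n))) delta;
    [rewrite delta0|exists k].
- by rewrite mulr_ge0// ?powR_ge0// exprn_ge0.
- exact: q01.
move=> k.
have Vk : (lebesgue (annulus x (r k) (r k.+1)) <= ((4 * r k) ^+ n)%:E)%E.
  rewrite -[leLHS](lebesgue_outer_preimage_translation x).
  have -> : 4 * r k = 2 * r k.+1 by rewrite /r exprSr; ring.
  apply: lebesgue_cube_le => [|y /andP[_]]; first exact: ltW.
  rewrite opprD addrCA subrr addr0 enormN => yr i.
  have := le_lt_trans (coord_le_enorm y i) yr.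
  by rewrite ltr_norml => /andP[-> /ltW].
apply: le_trans (integral_kernel_le s0 (r0 k) (measurable_annulus _ _ _) _ Vk)
  _.
  by move=> y /andP[].
rewrite lee_fin le_eqVlt; apply/orP; left; apply/eqP.
have := exprn_invr_powR s n (r0 k); rewrite subrr sub0r.
have -> : r k `^ (- s) = delta `^ (- s) * q ^+ k.
  by rewrite powRM ?exprn_ge0 ?ltW// powR_exprn.
by move=> h; rewrite /C -[in RHS]mulrA -h [(4 * _) ^+ _]exprMn; ring.
Qed.

End kernel_bounds.

(** * The calibration *)

Section integral_sets.
Local Open Scope ereal_scope.
Context d (T : measurableType d) (R : realType) {mu : {measure set T -> \bar
  R}}.
Variable f : T -> \bar R.
Hypotheses (mf : measurable_fun setT f) (f0 : forall x, 0 <= f x).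
Implicit Types A B D : set T.

Lemma ge0_integral_subsetT A B : measurable A -> measurable B -> A `<=` B ->
  \int[mu]_(x in A) f x <= \int[mu]_(x in B) f x.
Proof.
by move=> mA mB AB; apply: ge0_subset_integral AB => //;
  exact: measurable_funTS.
Qed.

Lemma ge0_le_integralT D (g : T -> \bar R) : measurable D ->
  measurable_fun setT g -> (forall x, D x -> f x <= g x) ->
  \int[mu]_(x in D) f x <= \int[mu]_(x in D) g x.
Proof.
move=> mD mg fg; apply: ge0_le_integral fg => //; exact: measurable_funTS.
Qed.

Lemma ge0_integralZT D (k : R) : measurable D -> (0 <= k)%R ->
  \int[mu]_(x in D) (k%:E * f x) = k%:E * \int[mu]_(x in D) f x.
Proof.
by move=> mD k0; apply: ge0_integralZl => //; exact: measurable_funTS.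
Qed.

Lemma ge0_integral_subsetU A B D : measurable A -> measurable B -> measurable D
  ->
  D `<=` A `|` B ->
  \int[mu]_(x in D) f x <= \int[mu]_(x in A) f x + \int[mu]_(x in B) f x.
Proof.
move=> mA mB mD DAB.
apply: (@le_trans _ _ (\int[mu]_(x in A `|` (B `\` A)) f x)).
  apply: ge0_subset_integral => //; first exact/measurableU/measurableD.
    exact: measurable_funTS.
  by move=> x /DAB; have [?|?] := pselect (A x); [left|case=> // ?; right].
rewrite ge0_integral_setU//.
- apply: leeD => //; apply: ge0_subset_integral => //; first exact: measurableD.
  exact: measurable_funTS.
- exact: measurableD.
- exact: measurable_funTS.
- by rewrite disj_set2E; apply/eqP;
  rewrite setIDA setIC setDE -setIA setICr setI0.
Qed.

Lemma ge0_integral_disjointU_le A B D :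
  measurable A -> measurable B -> measurable D ->
  A `<=` D -> B `<=` D -> A `&` B = set0 ->
  \int[mu]_(x in A) f x + \int[mu]_(x in B) f x <= \int[mu]_(x in D) f x.
Proof.
move=> mA mB mD AD BD AB; rewrite -ge0_integral_setU//.
- apply: ge0_subset_integral => //; first exact: measurableU.
    exact: measurable_funTS.
  by move=> x [/AD|/BD].
- exact: measurable_funTS.
- by rewrite disj_set2E; exact/eqP.
Qed.

End integral_sets.

Section calibration.
Context {R : realType} {n : nat}.
Local Notation T := (caratheodory_type (@lebesgue_outer R n)).
Implicit Types (x y z w p c : 'rV[R]_n) (s m delta : R).

Definition min_kernel s m x y : R := Num.min (frac_kernel s x y) m.

Lemma min_kernel_ge0 s m x y : 0 <= m -> 0 <= min_kernel s m x y.
Proof. by move=> m0; rewrite le_min frac_kernel_ge0. Qed.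

Lemma min_kernel_le s m x y : min_kernel s m x y <= frac_kernel s x y.
Proof. by rewrite ge_min lexx. Qed.

Lemma measurable_min_kernel s m d (X : measurableType d) (f g : X -> T) :
  measurable_fun setT f -> measurable_fun setT g ->
  measurable_fun setT (fun u => (min_kernel s m (f u : 'rV[R]_n) (g u))%:E).
Proof.
move=> mf mg; apply/measurable_EFinP; apply: measurable_minr.
  exact: measurable_frac_kernel.
exact: measurable_cst.
Qed.

Lemma measurable_min_kernelr s m z :
  measurable_fun [set: T] (fun y : T => (min_kernel s m z (y : 'rV[R]_n))%:E).
Proof.
exact: (measurable_min_kernel s m (@measurable_cst _ _ T T setT z)
  (@measurable_id _ T setT)).
Qed.

(* Near the level of [x] the sublevel sets of [bump c x] are balls smaller than
   the tangent ball, so just above that level they leave it only close to [x].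
     *)
Definition bump c x y : R := enorm (y - c) ^+ 2 + enorm (y - x) ^+ 2.

Definition bump_grad c x z : 'rV[R]_n := 2 *: (z - c) + 2 *: (z - x).

Lemma bumpD c x z w :
  bump c x (z + w) = bump c x z + dotrv (bump_grad c x z) w + 2 * enorm w ^+ 2.
Proof.
have sqrD v : enorm (v + w) ^+ 2 = enorm v ^+ 2 + 2 * dotrv v w + enorm w ^+ 2.
  by have := enorm_sqr_lin 1 1 v w; rewrite !scale1r => ->; ring.
rewrite /bump /bump_grad dotrv_linear ![z + w - _]addrAC !sqrD; ring.
Qed.

Lemma measurable_bump c x : measurable_fun [set: T] (fun y : T => bump c x y).
Proof.
rewrite (_ : (fun _ => _) = (fun y : T => enorm (c - (y : 'rV[R]_n)) ^+ 2 +
    enorm (x - (y : 'rV[R]_n)) ^+ 2)); last first.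
  by apply/funext => y; rewrite /bump enormBC [in X in _ + X]enormBC.
by apply: measurable_funD; apply: measurable_funX; exact: measurable_enormBr.
Qed.

Definition above c x z : set T := [set y | bump c x z < bump c x y].
Definition below c x z : set T := [set y | bump c x y < bump c x z].

Lemma measurable_above c x z : measurable (above c x z).
Proof. exact: (measurable_ltr_set (measurable_cst _) (measurable_bump c x)).
  Qed.

Lemma measurable_below c x z : measurable (below c x z).
Proof. exact: (measurable_ltr_set (measurable_bump c x) (measurable_cst _)).
  Qed.

Lemma measurable_eball z delta : measurable (eball z delta : set T).
Proof. exact: lebesgue_measurable_eball. Qed.

(** Reflection about [z] preserves the ball and the kernel and reverses the linear term of phi, so
    it sends [above] into [below] up to the slab. The error carries the full kernel and hence does
    not depend on [m]. *)
Lemma above_le_below s m c x z delta : 0 <= m ->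
  (\int[lebesgue]_(y in (eball z delta : set T) `&` above c x z)
     (min_kernel s m z y)%:E <=
   \int[lebesgue]_(y in (eball z delta : set T) `&` below c x z)
     (min_kernel s m z y)%:E +
   \int[lebesgue]_(y in slab (bump_grad c x z) z delta)
     (frac_kernel s z y)%:E)%E.
Proof.
move=> m0.
have mK := measurable_min_kernelr s m z.
have K0 y : (0 <= (min_kernel s m z y)%:E)%E by rewrite lee_fin min_kernel_ge0.
have mA := measurableI _ _ (measurable_eball z delta) (measurable_above c x z).
have mB := measurableI _ _ (measurable_eball z delta) (measurable_below c x z).
have reflE y : z + z - y - z = z - y by apply/rowP => i; rewrite !mxE; ring.
rewrite (ge0_integral_reflection (z + z) mA); last 2 first.
- exact: measurable_funTS.
- by move=> y _; exact: K0.
have KE y : min_kernel s m z (z + z - y) = min_kernel s m z y.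
  by rewrite /min_kernel frac_kernelC /frac_kernel reflE.
rewrite [leLHS](_ : _ = \int[lebesgue]_(y in [set y : T |
    ((eball z delta : set T) `&` above c x z) (z + z - (y : 'rV[R]_n))%R])
    (min_kernel s m z y)%:E)%E; last first.
  by apply: eq_integral => y _; rewrite KE.
have mS := measurable_slab (bump_grad c x z) z delta.
have mD := lebesgue_measurable_preimage_reflection (z + z) mA.
apply: le_trans (ge0_integral_subsetU mK K0 mB mS mD _) _.
  move=> y [/= yz]; rewrite /above /below /= => zy.
  rewrite /eball/= reflE in yz.
  have yE : (y : 'rV[R]_n) = z + (y - z) by rewrite addrC subrK.
  have dotN : dotrv (bump_grad c x z) (z - y) =
    - dotrv (bump_grad c x z) (y - z).
    rewrite ![dotrv (bump_grad _ _ _) _]dotrvC.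
    have := dotrv_linear (-1) 0 (y - z) 0 (bump_grad c x z).
    by rewrite scaler0 addr0 scaleN1r opprB mul0r addr0 mulN1r.
  move: zy; rewrite -addrA bumpD dotN => zy.
  (* With d the linear and q the quadratic term at [y], the reflected point being above says d < q.
     Either d < -q and [y] is below, or |d| <= q. *)
  have [lt|ge] := ltP (dotrv (bump_grad c x z) (y - z)) (- (2 * enorm (z - y)
    ^+ 2)).
    left; split; first by rewrite /eball/= enormBC.
    by rewrite /below/= yE bumpD [enorm (y - z)]enormBC; lra.
  by right; split => //; rewrite ler_norml ge/=; lra.
apply: leeD; first exact: lexx.
apply: ge0_le_integral.
- exact: mS.
- by move=> y _; exact: K0.
- exact: measurable_funTS.
- by apply: measurable_funTS; apply/measurable_EFinP;
  exact: measurable_frac_kernelr.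
- by move=> y _; rewrite lee_fin min_kernel_le.
Qed.

End calibration.

(** * Comparing a nearby centre with the tangency point *)

Section pointwise.
Context {R : realType} {n : nat}.
Local Notation T := (caratheodory_type (@lebesgue_outer R n)).
Implicit Types (x y z w p c : 'rV[R]_n) (s m delta tau eta : R).

(** The cancellation needs a ball centred at [z]; radius delta - tau keeps it inside the ball around
    [x]. The part missed lies in a ring whose points are at distance at least delta - 3 tau >= delta
    / 2 from [z], where the kernel is bounded. *)
Lemma near_above_le_below s m c x z delta tau (W V : R) :
  0 < s -> 0 <= m -> 0 < tau -> 6 * tau <= delta -> enorm (z - x) <= tau ->
  (\int[lebesgue]_(y in slab (bump_grad c x z) z (delta - tau))
     (frac_kernel s z y)%:E <= W%:E)%E ->
  (lebesgue ((eball x delta : set T) `\` eball x (delta - 2 * tau)) <=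
    V%:E)%E ->
  (\int[lebesgue]_(y in (eball x delta : set T) `&` above c x z)
     (min_kernel s m z y)%:E <=
   \int[lebesgue]_(y in (eball x delta : set T) `&` below c x z)
     (min_kernel s m z y)%:E + (W + ((delta / 2) `^ (n%:R + s))^-1 * V)%:E)%E.
Proof.
move=> s0 m0 tau0 tau_delta zx slabW ringV.
have mK := measurable_min_kernelr s m z.
have K0 y : (0 <= (min_kernel s m z y)%:E)%E by rewrite lee_fin min_kernel_ge0.
have mab := measurable_above c x z; have mbe := measurable_below c x z.
have mring := measurableD (measurable_eball x delta)
  (measurable_eball x (delta - 2 * tau)).
have mz := measurable_eball z (delta - tau).
have mx := measurable_eball x delta.
have cover : (eball x delta : set T) `&` above c x z `<=`
    ((eball z (delta - tau) : set T) `&` above c x z) `|`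
    ((eball x delta : set T) `\` eball x (delta - 2 * tau)).
  move=> y [xy aby]; have [yz|yz]
    := ltP (enorm ((y : 'rV[R]_n) - z)) (delta - tau).
    by left.
  right; split => //; rewrite /eball/= => xy'; move: yz;
    rewrite leNgt => /negP; apply.
  apply: le_lt_trans (enormB_triangle x y z) _.
  by rewrite [enorm (x - z)]enormBC; lra.
apply: (le_trans (ge0_integral_subsetU mK K0 (measurableI _ _ mz mab) mring
  (measurableI _ _ mx mab) cover)).
have ringK : (\int[lebesgue]_(y in (eball x delta : set T) `\` eball x (delta -
  2 * tau))
    (min_kernel s m z y)%:E <= (((delta / 2) `^ (n%:R + s))^-1 * V)%:E)%E.
  have d2 : 0 < delta / 2 by lra.
  apply: le_trans (integral_kernel_le (x := z) s0 d2 mring _ ringV).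
    apply: ge0_le_integral.
    - exact: mring.
    - by move=> y _; exact: K0.
    - exact: measurable_funTS.
    - apply: measurable_funTS; apply/measurable_EFinP.
      exact: measurable_frac_kernelr.
    - by move=> y _; rewrite lee_fin min_kernel_le.
  move=> y [_ /negP]; rewrite -leNgt /= => yx.
  have := enormB_triangle z y x; rewrite [enorm (z - y)]enormBC; lra.
rewrite EFinD [leRHS]addeA; apply: leeD; last exact: ringK.
apply: le_trans (above_le_below s c x z (delta - tau) m0) _.
apply: leeD; last exact: slabW.
apply: ge0_subset_integral.
- exact: measurableI.
- exact: measurableI.
- exact: measurable_funTS.
- by move=> y _; exact: K0.
move=> y [yz bey]; split=> //; apply: le_lt_trans (enormB_triangle z y x) _.
by move: yz; rewrite /eball/=; lra.
Qed.

Lemma bernoulli_le (t : R) (N : nat) : 0 <= t <= 1 -> 1 - N%:R * t <=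
  (1 - t) ^+ N.
Proof.
move=> /andP[t0 t1]; elim: N => [|N IH]; first by rewrite mul0r subr0.
rewrite exprS; apply: (@le_trans _ _ ((1 - t) * (1 - N%:R * t))).
  have : 0 <= N%:R * t * t by rewrite !mulr_ge0.
  by rewrite -natr1; lra.
by rewrite ler_wpM2l// subr_ge0.
Qed.

(** The real exponent is replaced by the integer n + 1, for which Bernoulli gives (1 - t)^(n+1) >= 1
    - eta. The two bounds then follow from (1 - t)^(n+1) (1 + t)^(n+1) <= 1 and, as eta <= 1/2, from
    (1 + 2 eta) (1 - eta) >= 1. *)
Lemma powR_near1 (a t eta u : R) : 0 <= a <= n.+1%:R -> 0 <= t ->
  n.+1%:R * t <= eta -> eta <= 2^-1 -> 1 - t <= u <= 1 + t ->
  1 - eta <= (u `^ a)^-1 <= 1 + 2 * eta.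
Proof.
move=> /andP[a0 an] t0 tN eta2 /andP[tu ut].
have t1 : t <= 2^-1.
  apply: le_trans _ (le_trans tN eta2); rewrite ler_peMl// ler1n//.
have u0 : 0 < u by lra.
have pow_ge : (1 - t) ^+ n.+1 <= u `^ a.
  have [u1|u1] := leP 1 u.
    apply: (@le_trans _ _ 1); first by rewrite exprn_ile1//; lra.
    have p1 : 1 `^ a = 1 :> R by rewrite powR1.
    by rewrite -[leLHS]p1; apply: ge0_ler_powR => //; rewrite nnegrE// ltW.
  apply: (@le_trans _ _ (u ^+ n.+1)).
    by rewrite ler_pXn2r// nnegrE; lra.
  rewrite -powR_mulrn ?(ltW u0)//; apply: ger_powR => //.
  by rewrite u0 ltW.
have pow_le : u `^ a <= (1 + t) ^+ n.+1.
  have [u1|u1] := leP 1 u.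
    apply: (@le_trans _ _ (u ^+ n.+1)).
      rewrite -powR_mulrn ?(ltW u0)//; exact: ler_powR.
    by rewrite ler_pXn2r// nnegrE; lra.
  apply: (@le_trans _ _ 1).
    have p1 : 1 `^ a = 1 :> R by rewrite powR1.
    by rewrite -[leRHS]p1; apply: ge0_ler_powR => //; rewrite ?nnegrE ltW.
  by rewrite exprn_ege1//; lra.
have bern : 1 - eta <= (1 - t) ^+ n.+1.
  apply: le_trans _ (@bernoulli_le t n.+1 _); first by rewrite lerD2l lerN2.
  by rewrite t0; lra.
have ua : 0 < u `^ a by rewrite powR_gt0.
have prod1 : (1 - t) ^+ n.+1 * (1 + t) ^+ n.+1 <= 1.
  rewrite -exprMn exprn_ile1//.
    by rewrite mulr_ge0; lra.
  by have := sqr_ge0 t; rewrite expr2; lra.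
apply/andP; split.
  apply: (le_trans bern); rewrite -(ler_pM2r ua) mulVf ?gt_eqF//.
  by apply: le_trans prod1; rewrite ler_wpM2l// exprn_ge0//; lra.
rewrite -(ler_pM2r ua) mulVf ?gt_eqF//.
apply: (@le_trans _ _ ((1 + 2 * eta) * (1 - eta))).
  have eta0 : 0 <= eta by apply: le_trans tN; rewrite mulr_ge0.
  have : 0 <= eta * (1 - 2 * eta) by rewrite mulr_ge0//; lra.
  by lra.
rewrite ler_wpM2l ?(le_trans bern)//.
have eta0 : 0 <= eta by apply: le_trans tN; rewrite mulr_ge0.
by lra.
Qed.

(** Since |z - x| <= t delta <= t |x - y|, the ratio |z - y| / |x - y| lies within t of 1. *)
Lemma frac_kernel_compare s x z y delta t eta : 0 < s < 1 -> 0 < delta -> 0 <=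
  t ->
  n.+1%:R * t <= eta -> eta <= 2^-1 ->
  enorm (z - x) <= t * delta -> delta <= enorm (x - y) ->
  (1 - eta) * frac_kernel s x y <= frac_kernel s z y <=
    (1 + 2 * eta) * frac_kernel s x y.
Proof.
move=> /andP[s0 s1] delta0 t0 tN eta2 zx xy.
have xy0 : 0 < enorm (x - y) by exact: lt_le_trans xy.
have txy : enorm (z - x) <= t * enorm (x - y).
  by apply: (le_trans zx); rewrite ler_wpM2l.
pose u := enorm (z - y) / enorm (x - y).
have uE : enorm (z - y) = u * enorm (x - y) by rewrite divfK// gt_eqF.
have u0 : 0 <= u by rewrite divr_ge0// enorm_ge0.
have /andP[lo hi] : 1 - eta <= (u `^ (n%:R + s))^-1 <= 1 + 2 * eta.
  apply: (@powR_near1 _ t) => //.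
    apply/andP; split; first by rewrite addr_ge0// ltW.
    by rewrite -natr1 lerD2l ltW.
  rewrite /u ler_pdivlMr// ler_pdivrMr//.
  have := enormB_triangle x z y; have := enormB_triangle z x y.
  by rewrite [enorm (x - z)]enormBC; lra.
have -> : frac_kernel s z y = (u `^ (n%:R + s))^-1 * frac_kernel s x y.
  by rewrite /frac_kernel uE powRM ?enorm_ge0// invfM.
by rewrite !ler_wpM2r ?frac_kernel_ge0.
Qed.

End pointwise.

(** * The calibration inequality at a single point *)

Section assembly.
Context {R : realType} {n : nat}.
Local Notation T := (caratheodory_type (@lebesgue_outer R n)).
Implicit Types (x y z w p c : 'rV[R]_n) (s m b delta tau eta M : R).
Implicit Types (E A : set T).

Definition far x delta : set T := [set y | delta <= enorm (x - (y : 'rV[R]_n))].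

Lemma measurable_far x delta : measurable (far x delta).
Proof. exact: (measurable_ler_set (measurable_cst _) (measurable_enormBr x)).
  Qed.

Lemma farE x delta : far x delta = ~` eball x delta.
Proof.
apply/seteqP; split => y; rewrite /far /eball/= enormBC.
  by rewrite leNgt => /negP.
by move/negP; rewrite -leNgt.
Qed.

(** The positive and negative parts of the integrand live on [E] and on its complement. The negative
    one has finite integral away from [x], so it can be moved across; from here on only sums of
    nonnegative integrals occur. *)
Lemma truncated_curvature_gt s E x delta b : 0 < s -> 0 < delta -> measurable E
  ->
  (b%:E < truncated_curvature s E x delta)%E ->
  (\int[lebesgue]_(y in far x delta `\` E) (frac_kernel s x y)%:E + b%:E <=
   \int[lebesgue]_(y in far x delta `&` E) (frac_kernel s x y)%:E)%E.
Proof.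
move=> s0 delta0 mE; rewrite /truncated_curvature -farE integralE.
have K0 y : 0 <= frac_kernel s x y by exact: frac_kernel_ge0.
rewrite [X in (_ < X - _)%E -> _](_ : _ =
    \int[lebesgue]_(y in far x delta `&` E) (frac_kernel s x y)%:E)%E;
      last first.
  rewrite integral_mkcondr; apply: eq_integral => y _.
  rewrite /patch funeposE !indicE in_setC.
  by case: (y \in E); rewrite /= ?subr0 ?sub0r ?mul1r ?mulN1r -EFin_max;
     congr (_%:E); [rewrite max_l|rewrite max_r// oppr_le0].
rewrite [X in (_ < _ - X)%E -> _](_ : _ =
    \int[lebesgue]_(y in far x delta `\` E) (frac_kernel s x y)%:E)%E;
      last first.
  rewrite setDE integral_mkcondr; apply: eq_integral => y _.
  rewrite /patch funenegE !indicE in_setC.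
  by case: (y \in E); rewrite /= ?subr0 ?sub0r ?mul1r ?mulN1r ?opprK;
     rewrite -?EFinN -EFin_max; congr (_%:E);
       [rewrite max_r// oppr_le0|rewrite ?opprK max_l].
set P := (X in (_ < X - _)%E -> _); set Q := (X in (_ < _ - X)%E -> _).
have Qfin : Q \is a fin_num.
  rewrite ge0_fin_numE; last by apply: integral_ge0 => y _; rewrite lee_fin.
  apply: le_lt_trans (far_kernel_integral_lty x s0 delta0).
  apply: ge0_integral_subsetT; [|by move=> y;
    rewrite lee_fin| | |exact: subDsetl].
  - by apply/measurable_EFinP; exact: measurable_frac_kernelr.
  - by apply: measurableD => //; exact: measurable_far.
  - exact: measurable_far.
by rewrite lteBrDr// => /ltW; rewrite addeC.
Qed.

(** Points outside the ball are at distance at least delta / 2 from [z], so the truncation at [m] is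
    inactive there. The relative errors eta on [E] and 2 eta off [E] cost at most 3 eta M <= b /
    2. *)
Lemma far_estimate s m E x z delta t eta b M : 0 < s < 1 -> 0 < delta ->
  0 <= t -> n.+1%:R * t <= eta -> eta <= 2^-1 -> enorm (z - x) <= t * delta ->
  ((delta / 2) `^ (n%:R + s))^-1 <= m -> measurable E ->
  (\int[lebesgue]_(y in far x delta) (frac_kernel s x y)%:E <= M%:E)%E ->
  3 * eta * M <= b / 2 ->
  (\int[lebesgue]_(y in far x delta `\` E) (frac_kernel s x y)%:E + b%:E <=
   \int[lebesgue]_(y in far x delta `&` E) (frac_kernel s x y)%:E)%E ->
  (\int[lebesgue]_(y in far x delta `\` E) (min_kernel s m z y)%:E +
    (b / 2)%:E <=
   \int[lebesgue]_(y in far x delta `&` E) (min_kernel s m z y)%:E)%E.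
Proof.
move=> s01 delta0 t0 tN eta2 zx m_ge mE leM etaM.
have /andP[s0 s1] := s01.
have mF := measurable_far x delta.
have mFE := measurableI _ _ mF mE; have mFD := measurableD mF mE.
have mK : measurable_fun setT (fun y : T => (frac_kernel s x y)%:E).
  by apply/measurable_EFinP; exact: measurable_frac_kernelr.
have K0 y : (0 <= (frac_kernel s x y)%:E)%E by rewrite lee_fin frac_kernel_ge0.
have m0 : 0 <= m by apply: le_trans m_ge; rewrite invr_ge0 powR_ge0.
have mKm := measurable_min_kernelr s m z.
have Km0 y : (0 <= (min_kernel s m z y)%:E)%E by rewrite lee_fin min_kernel_ge0.
have eta0 : 0 <= eta by apply: le_trans tN; rewrite mulr_ge0.
have t2 : t <= 2^-1.
  by apply: le_trans _ (le_trans tN eta2); rewrite ler_peMl// ler1n.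
have Kcmp y : far x delta y -> (1 - eta) * frac_kernel s x y <=
    min_kernel s m z y <= (1 + 2 * eta) * frac_kernel s x y.
  move=> xy; rewrite /min_kernel min_l;
    first exact: (frac_kernel_compare s01 delta0 t0).
  apply: le_trans m_ge; apply: frac_kernel_le => //; first by rewrite divr_gt0.
  have : t * delta <= 2^-1 * delta by rewrite ler_wpM2r// ltW.
  have := enormB_triangle z x y; rewrite [enorm (x - z)]enormBC.
  by move: xy; rewrite /far/=; lra.
have leFM S : measurable S -> S `<=` far x delta ->
    (\int[lebesgue]_(y in S) (frac_kernel s x y)%:E <= M%:E)%E.
  by move=> mS SF; apply: le_trans leM; exact: ge0_integral_subsetT.
have fin S : measurable S -> S `<=` far x delta ->
    (\int[lebesgue]_(y in S) (frac_kernel s x y)%:E)%E \is a fin_num.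
  move=> mS SF; rewrite ge0_fin_numE; last exact: integral_ge0.
  exact: le_lt_trans (leFM _ mS SF) (ltry _).
have hi : (\int[lebesgue]_(y in far x delta `\` E) (min_kernel s m z y)%:E <=
    (1 + 2 * eta)%:E * \int[lebesgue]_(y in far x delta `\` E) (frac_kernel s x
      y)%:E)%E.
  rewrite -(ge0_integralZT mK K0)//; last by lra.
  apply: (ge0_le_integralT mKm Km0 mFD); first exact: measurable_funeM.
  by move=> y [/Kcmp/andP[_ ? _]]; rewrite -EFinM lee_fin.
have lo : ((1 - eta)%:E * \int[lebesgue]_(y in far x delta `&` E) (frac_kernel
  s x y)%:E
    <= \int[lebesgue]_(y in far x delta `&` E) (min_kernel s m z y)%:E)%E.
  rewrite -(ge0_integralZT mK K0)//; last by lra.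
  apply: (ge0_le_integralT _ _ mFE mKm); first exact: measurable_funeM.
  - by move=> y; apply: mule_ge0; [rewrite lee_fin; lra|exact: K0].
  - by move=> y [/Kcmp/andP[? _ _]]; rewrite -EFinM lee_fin.
have finP := fin _ mFE (@subIsetl _ _ _);
  have finQ := fin _ mFD (@subDsetl _ _ _).
have leP := leFM _ mFE (@subIsetl _ _ _);
  have leQ := leFM _ mFD (@subDsetl _ _ _).
move: hi lo leP leQ; rewrite -(fineK finP) -(fineK finQ).
set Q := fine _; set P := fine _;
  rewrite -!EFinM -EFinD !lee_fin => hi lo PM QM bPQ.
apply: le_trans _ lo; apply: (@le_trans _ _ ((1 + 2 * eta) * Q + b / 2)%:E).
  by rewrite EFinD; apply: leeD; [exact: hi|exact: lexx].
rewrite lee_fin; have : eta * P <= eta * M by rewrite ler_wpM2l.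
by have : eta * Q <= eta * M by [rewrite ler_wpM2l]; lra.
Qed.

(** Bookkeeping for [calibration_le]: [F] and [N] are the far and near integrals over [E], [F'] and
    [N'] those off [E] and off E u A, and [ab], [be] stand for above and below. Stated with sums
    only, it asks for no finiteness. *)
Lemma calibration_chain (CEA Aab Abe IE F' F N' N Nab Nbe c : \bar R) :
  (CEA <= F' + N' -> N' + Aab <= Nab -> Nbe <= N + Abe -> F + N <= IE ->
   F' + (c + c) <= F -> Nab <= Nbe + c -> CEA + Aab + c <= IE + Abe)%E.
Proof.
move=> h1 h2 h3 h4 hF hN.
apply: (@le_trans _ _ (F + Nbe)%E); last first.
  by apply: (le_trans (leeD (lexx F) h3)); rewrite addeA leeD.
apply: (@le_trans _ _ (F' + (c + c) + Nbe)%E); last by rewrite leeD.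
rewrite (_ : F' + (c + c) + Nbe = F' + (Nbe + c) + c)%E; last first.
  by rewrite -!addeA [(Nbe + (c + c))%E]addeC !addeA.
apply: leeD => //; apply: (@le_trans _ _ (F' + Nab)%E); last by rewrite leeD.
by apply: le_trans (leeD h1 (lexx Aab)) _; rewrite -addeA leeD.
Qed.

(** In the ball, a point outside E u A has phi >= [lev] > phi z, so it is above; a point below lies
    in E or in A. Of the far margin b + b, one half pays for the near asymmetry. *)
Lemma calibration_le s m c x z E A delta lev b : 0 <= m ->
  measurable E -> measurable A ->
  A `<=` eball x delta -> E `&` A = set0 ->
  bump c x z < lev ->
  (forall y : T, ~ E y -> bump c x y < lev -> A y) ->
  (\int[lebesgue]_(y in far x delta `\` E) (min_kernel s m z y)%:E + (b +
    b)%:E <=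
   \int[lebesgue]_(y in far x delta `&` E) (min_kernel s m z y)%:E)%E ->
  (\int[lebesgue]_(y in (eball x delta : set T) `&` above c x z)
     (min_kernel s m z y)%:E <=
   \int[lebesgue]_(y in (eball x delta : set T) `&` below c x z)
     (min_kernel s m z y)%:E + b%:E)%E ->
  (\int[lebesgue]_(y in ~` (E `|` A)) (min_kernel s m z y)%:E +
   \int[lebesgue]_(y in A `&` above c x z) (min_kernel s m z y)%:E + b%:E <=
   \int[lebesgue]_(y in E) (min_kernel s m z y)%:E +
   \int[lebesgue]_(y in A `&` below c x z) (min_kernel s m z y)%:E)%E.
Proof.
move=> m0 mE mA Anear EA zlev Alev hfar hnear.
have mK := measurable_min_kernelr s m z.
have K0 y : (0 <= (min_kernel s m z y)%:E)%E by rewrite lee_fin min_kernel_ge0.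
have mF := measurable_far x delta; have mN := measurable_eball x delta.
have mab := measurable_above c x z; have mbe := measurable_below c x z.
have mEA := measurableU _ _ mE mA; have mCEA := measurableC mEA.
have FN (y : T) : ~ eball x delta y -> far x delta y by rewrite farE.
have sub1 : ~` (E `|` A) `<=` (far x delta `\` E) `|` ((eball x delta : set T)
  `&` ~` (E `|` A)).
  move=> y yEA; have [yN|/FN yF] := pselect (eball x delta y); first by right.
  by left; split=> // Ey; apply: yEA; left.
have := ge0_integral_subsetU (mu := lebesgue) mK K0 (measurableD mF mE)
  (measurableI _ _ mN mCEA) mCEA sub1.
have := ge0_integral_disjointU_le (mu := lebesgue) mK K0 (measurableI _ _ mN
  mCEA)
  (measurableI _ _ mA mab) (measurableI _ _ mN mab).
have sub2 : (eball x delta : set T) `&` ~` (E `|` A) `<=`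
    (eball x delta : set T) `&` above c x z.
  move=> y [yN yEA]; split=> //; rewrite /above/=; apply: (lt_le_trans zlev).
  rewrite leNgt; apply/negP => ylev; apply: yEA.
  by have [Ey|nEy] := pselect (E y); [left|right; exact: Alev].
have sub3 : A `&` above c x z `<=` (eball x delta : set T) `&` above c x z.
  exact: setSI.
have dis : ((eball x delta : set T) `&` ~` (E `|` A)) `&` (A `&` above c x z) =
  set0.
  by rewrite -subset0 => y [[_ yEA] [Ay _]]; apply: yEA; right.
move=> /(_ sub2 sub3 dis).
have := ge0_integral_subsetU (mu := lebesgue) mK K0 (measurableI _ _ mN mE)
  (measurableI _ _ mA mbe) (measurableI _ _ mN mbe).
have sub4 : (eball x delta : set T) `&` below c x z `<=`
    ((eball x delta : set T) `&` E) `|` (A `&` below c x z).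
  move=> y [yN ybe]; have [Ey|nEy] := pselect (E y); first by left.
  by right; split=> //; apply: Alev => //; exact: lt_trans zlev.
move=> /(_ sub4).
have := ge0_integral_disjointU_le (mu := lebesgue) mK K0 (measurableI _ _ mF mE)
  (measurableI _ _ mN mE) mE (@subIsetr _ _ _) (@subIsetr _ _ _).
have dis2 : (far x delta `&` E) `&` ((eball x delta : set T) `&` E) = set0.
  by rewrite farE -subset0 => y [[+ _] [? _]]; apply.
move=> /(_ dis2).
move=> I4 I3 I2 I1; exact: (calibration_chain (c := b%:E) I1 I2 I3 I4 hfar
  hnear).
Qed.

End assembly.

(** * Balls and open sets *)

Section balls.
Context {R : realType} {n : nat}.
Local Notation T := (caratheodory_type (@lebesgue_outer R n)).
Implicit Types (x y z : 'rV[R]_n).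

Lemma rat_dense_enorm x (e : R) : 0 < e ->
  exists q : 'rV[rat]_n, enorm (x - map_mx ratr q) < e.
Proof.
move=> e0; have : 0 < e / n.+1%:R by rewrite divr_gt0.
move eE : (e / n.+1%:R) => a a0.
have [q xq] : {q : 'I_n -> rat & forall i,
    ratr (q i) \in `]x ord0 i - a, x ord0 i + a[}.
  apply: (@choice _ _ (fun i q => ratr q \in `]x ord0 i - a,
    x ord0 i + a[)) => i.
  by apply: rat_in_itvoo; lra.
exists (\row_i q i); apply: enorm_lt_of_coord => // i; rewrite eE !mxE.
have := xq i; rewrite in_itv/= ltr_norml => /andP[lo hi].
by apply/andP; split; lra.
Qed.

(** An open set is the union of the countably many balls inside it with rational centre and radius 1
    / (k + 1). *)
Lemma open_lebesgue_measurable (Omega : set 'rV[R]_n) :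
  open Omega -> lebesgue_measurable Omega.
Proof.
move=> oO; pose B (i : 'rV[rat]_n * nat) : set 'rV[R]_n :=
  eball (map_mx ratr i.1) i.2.+1%:R^-1.
pose F i : set T := if `[< B i `<=` Omega >] then B i else set0.
have -> : Omega = \bigcup_i F i.
  apply/seteqP; split => [x Ox|x [i _]]; last first.
    by rewrite /F; case: asboolP => [BO|_ //]; exact: BO.
  have [e e0 eO] := open_eball_subset oO Ox.
  have [k ke] : exists k, 2 * k.+1%:R^-1 < e.
    exists (Num.truncn (2 / e)); rewrite ltr_pdivrMr// mulrC -ltr_pdivrMr//.
    exact: truncnS_gt.
  have [q xq] := rat_dense_enorm x (ltac:(by rewrite invr_gt0) : 0 < k.+1%:R^-1
    :> R).
  exists (q, k) => //; rewrite /F; case: asboolP => [_|[]]; first exact: xq.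
  move=> y; rewrite /B /eball/= => qy; apply: eO; rewrite /eball/=.
  apply: le_lt_trans (enormB_triangle (map_mx ratr q) y x) _.
  rewrite [enorm (map_mx _ _ - x)]enormBC; apply: lt_trans ke.
  by rewrite mulr_natl mulr2n ltrD.
apply: (@countable_bigcupT_measurable _ T); first exact: countableP.
move=> i; rewrite /F; case: ifP => _; last exact: (@measurable0 _ T).
exact: lebesgue_measurable_eball.
Qed.

Lemma lebesgue_eball_lty x (r : R) : (lebesgue (eball x r) < +oo)%E.
Proof.
have [r0|r0] := ltP 0 r; last first.
  rewrite (_ : eball x r = set0) ?measure0//.
  by rewrite -subset0 => y; rewrite /eball/= ltNge (le_trans r0)// enorm_ge0.
apply: le_lt_trans (ltry ((2 * r) ^+ n)).
rewrite -[leLHS](lebesgue_outer_preimage_translation x).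
apply: lebesgue_cube_le => [|y]; first exact: ltW.
rewrite /eball/= addrK => yr i.
have := le_lt_trans (coord_le_enorm y i) yr.
by rewrite ltr_norml => /andP[-> /ltW].
Qed.

(** The scaling inequality in the direction that turns |E n B_r| < omega_n r^n into |B_r - E| >
    0. *)
Lemma ball_volume_le x (r : R) : 0 < r -> (ball_volume (n := n) r <=
  lebesgue (eball x r))%E.
Proof.
move=> r0; have rn0 : 0 < r ^+ n by rewrite exprn_gt0.
have := @lebesgue_outer_preimage_affine_le R n r x (eball x r) (lt0r_neq0 r0).
rewrite (_ : [set y | _] = eball 0 1); last first.
  apply/seteqP; split => y; rewrite /eball/= addrK subr0 enormZ gtr0_norm//.
    by rewrite gtr_pMr.
  by rewrite gtr_pMr.
rewrite gtr0_norm// => h; rewrite /ball_volume.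
apply: le_trans (lee_wpmul2r _ h) _; first by rewrite lee_fin ltW.
by rewrite muleAC -EFinM exprVn mulVf ?gt_eqF// mul1e.
Qed.

(** Continuity from above: the ball is open, so the rings decrease to the empty set, and they have
    finite measure. *)
Lemma ring_volume_small x (r V : R) : 0 < V -> exists2 tau0 : R, 0 < tau0 &
  forall tau, 0 < tau <= tau0 ->
    (lebesgue ((eball x r : set T) `\` eball x (r - 2 * tau)) <= V%:E)%E.
Proof.
move=> V0; pose F k : set T := (eball x r : set T) `\` eball x (r - k.+1%:R^-1).
have mF k : measurable (F k) by apply: measurableD; exact: measurable_eball.
have F0 : \bigcap_k F k = set0.
  rewrite -subset0 => y Fy; have [yr _] := Fy 0%N I.
  have yr0 : 0 < r - enorm ((y : 'rV[R]_n) - x) by rewrite subr_gt0.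
  pose k := Num.truncn (r - enorm ((y : 'rV[R]_n) - x))^-1.
  have [_] := Fy k I; apply; rewrite /eball/= ltrBrDl -ltrBrDr.
  by rewrite invf_plt ?posrE//; exact: truncnS_gt.
have nF : nonincreasing_seq F.
  move=> j k jk; apply/subsetPset => y [yr yk]; split=> // yj; apply: yk.
  apply: (lt_le_trans yj); rewrite lerB// lef_pV2 ?posrE//.
  by rewrite ler_nat.
have fin0 : (lebesgue (F 0%N) < +oo)%E.
  apply: le_lt_trans (lebesgue_eball_lty x r).
  exact: (le_lebesgue_outer (@subDsetl _ _ _)).
have := nonincreasing_cvg_mu fin0 mF _ nF.
rewrite F0 measure0 => /(_ (@measurable0 _ T)) cF.
have [k kV] : exists k, (lebesgue (F k) < V%:E)%E.
  have : \forall k \near \oo, (lebesgue (F k) < V%:E)%E.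
    by apply: (cF [set u | (u < V%:E)%E]); apply: open_ereal_lt';
      rewrite lte_fin.
  by move=> [k _ /(_ k (leqnn k)) kV]; exists k.
exists (k.+1%:R^-1 / 2); first by rewrite divr_gt0.
move=> tau /andP[tau0 tauk]; apply: le_trans (ltW kV).
apply: le_lebesgue_outer => y [yr yt]; split=> // yk; apply: yt.
apply: lt_le_trans yk _; rewrite lerB//.
  by move: tauk; rewrite ler_pdivlMr// mulrC.
Qed.

End balls.

(** * Interaction of sets and minimality *)

Section iterated_integral.
Local Open Scope ereal_scope.
Context d (T : measurableType d) (R : realType)
  {mu : {sigma_finite_measure set T -> \bar R}}.
Implicit Types (A B : set T) (f : T * T -> \bar R).

Lemma measurable_inner_integral f B : measurable B ->
  measurable_fun setT f -> (forall u, 0 <= f u) ->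
  measurable_fun setT (fun x => \int[mu]_(y in B) f (x, y)).
Proof.
move=> mB mf f0; pose g := f \_ ([set: T] `*` B).
rewrite (_ : (fun x => _) = fubini_F mu g); last first.
  apply/funext => x; rewrite /fubini_F [LHS]integral_mkcond.
  by apply: eq_integral => y _; rewrite /g /patch in_setX in_setT.
have mg : measurable_fun setT g.
  apply/(measurable_restrictT _ (measurableX measurableT mB)).
  exact: measurable_funTS.
by apply: (measurable_fun_fubini_tonelli_F g) => // u; apply: erestrict_ge0.
Qed.

Lemma integral_swap f A B : measurable A -> measurable B ->
  measurable_fun setT f -> (forall u, 0 <= f u) ->
  \int[mu]_(x in A) \int[mu]_(y in B) f (x, y) =
  \int[mu]_(y in B) \int[mu]_(x in A) f (x, y).
Proof.
move=> mA mB mf f0; pose g := f \_ (A `*` B).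
have mg : measurable_fun setT g.
  apply/(measurable_restrictT _ (measurableX mA mB)); exact: measurable_funTS.
have g0 u : 0 <= g u by apply: erestrict_ge0.
have := @fubini_tonelli _ _ _ _ _ mu mu g mg g0.
rewrite [X in X = _ -> _](_ : _ = \int[mu]_(x in A) \int[mu]_(y in B) f (x,
  y)); last first.
  rewrite [RHS]integral_mkcond; apply: eq_integral => x _; rewrite [RHS]/patch.
  case: ifPn => xA.
    rewrite [RHS]integral_mkcond; apply: eq_integral => y _.
    by rewrite /g /patch in_setX xA.
  apply: integral0_eq => y _.
  by rewrite /g /patch in_setX (negbTE xA).
move=> ->; rewrite [RHS]integral_mkcond; apply: eq_integral => y _.
rewrite [RHS]/patch; case: ifPn => yB.
  rewrite [RHS]integral_mkcond; apply: eq_integral => x _.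
  by rewrite /g /patch in_setX yB andbT.
apply: integral0_eq => x _.
by rewrite /g /patch in_setX (negbTE yB) andbF.
Qed.

End iterated_integral.

Section interaction.
Context {R : realType} {n : nat}.
Local Notation T := (caratheodory_type (@lebesgue_outer R n)).
Implicit Types (s m : R) (A B C E F : set T).

Lemma measurable_frac_kernel2 s : measurable_fun [set: T * T]
  (fun u => (frac_kernel s (u.1 : 'rV[R]_n) u.2)%:E).
Proof.
apply/measurable_EFinP.
exact: (measurable_frac_kernel s measurable_fst measurable_snd).
Qed.

Lemma frac_kernel_EFin_ge0 s (x y : 'rV[R]_n) : (0 <= (frac_kernel s x y)%:E)%E.
Proof. by rewrite lee_fin frac_kernel_ge0. Qed.

Let mK2 := measurable_frac_kernel2.
Let K0 := frac_kernel_EFin_ge0.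

Let mK1 s x : measurable_fun [set: T]
  (fun y : T => (frac_kernel s x (y : 'rV[R]_n))%:E).
Proof. by apply/measurable_EFinP; exact: measurable_frac_kernelr. Qed.

Let mI s B (mB : measurable B) : measurable_fun [set: T]
  (fun x : T => \int[lebesgue]_(y in B) (frac_kernel s (x : 'rV[R]_n) y)%:E)%E.
Proof. exact: (measurable_inner_integral mB (mK2 s) (fun u =>
  K0 s u.1 u.2)). Qed.

Let I0 s B (x : T) :
  (0 <= \int[lebesgue]_(y in B) (frac_kernel s (x : 'rV[R]_n) y)%:E)%E.
Proof. by apply: integral_ge0 => y _; exact: K0. Qed.

Lemma interaction_ge0 s A B : (0 <= interaction s A B)%E.
Proof. by apply: integral_ge0 => x _; exact: I0. Qed.

Lemma interactionC s A B : measurable A -> measurable B ->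
  interaction s A B = interaction s B A.
Proof.
move=> mA mB; rewrite /interaction.
rewrite (integral_swap mA mB (mK2 s) (fun u => K0 s u.1 u.2)) /=.
apply: eq_integral => y _; apply: eq_integral => x _.
by rewrite frac_kernelC.
Qed.

Lemma interactionUl s A B C : measurable A -> measurable B -> measurable C ->
  A `&` B = set0 ->
  interaction s (A `|` B) C = (interaction s A C + interaction s B C)%E.
Proof.
move=> mA mB mC AB; apply: ge0_integral_setU.
- exact: mA.
- exact: mB.
- by apply: measurable_funTS; exact: mI.
- by move=> x _; exact: I0.
- by rewrite disj_set2E AB.
Qed.

Lemma interactionUr s A B C : measurable A -> measurable B -> measurable C ->
  B `&` C = set0 ->
  interaction s A (B `|` C) = (interaction s A B + interaction s A C)%E.
Proof.
move=> mA mB mC BC; rewrite interactionC; [|exact: mA|exact: measurableU].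
rewrite interactionUl; [|exact: mB|exact: mC|exact: mA|exact: BC].
by rewrite (interactionC s mB mA) (interactionC s mC mA).
Qed.

(** The competitor is E u A. Splitting CE as D u A, the perimeters share L(E n Omega, D) + L(E -
    Omega, D n Omega), which is finite; what remains is L(A, E) for [E] against L(A, D) for the
    competitor. *)
Lemma s_minimal_exterior s E Omega A : s_minimal s E Omega ->
  measurable (Omega : set T) -> measurable A -> A `<=` Omega -> E `&` A =
    set0 ->
  (interaction s A E < +oo)%E /\
  (interaction s A E <= interaction s A (~` (E `|` A)))%E.
Proof.
move=> [mE finE minE] mO mA AO EA.
have mF : measurable (E `|` A) by exact: measurableU.
have FE : (E `|` A) `\` Omega = E `\` Omega.
  rewrite setDUl (_ : A `\` Omega = set0) ?setU0//.
  by rewrite -subset0 => y [/AO].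
have := minE _ mF FE; move: finE; rewrite /s_perimeter FE.
set D := ~` (E `|` A).
have mD : measurable D by exact: measurableC.
have CE : ~` E = D `|` A.
  apply/seteqP; split => [y yE|y [yD yE|yA yE]].
  - by have [yA|yA] := pselect (A y); [right|left => -[]].
  - by apply: yD; left.
  - by have : (E `&` A) y by []; rewrite EA.
have CEO : ~` E `&` Omega = (D `&` Omega) `|` A.
  by rewrite CE setIUl (setIidl AO).
have FO : (E `|` A) `&` Omega = (E `&` Omega) `|` A.
  by rewrite setIUl (setIidl AO).
have DA : D `&` A = set0 by rewrite -subset0 => y [yD yA]; apply: yD; right.
have DOA : D `&` Omega `&` A = set0 by rewrite setIAC DA set0I.
have EOA : E `&` Omega `&` A = set0 by rewrite setIAC EA set0I.
have mEO := measurableI _ _ mE mO; have mE' := measurableD mE mO.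
have mDO := measurableI _ _ mD mO.
rewrite FO CEO CE (interactionUr s mEO mD mA DA) (interactionUr s mE' mDO mA
  DOA).
rewrite (interactionUl s mEO mA mD EOA).
have -> : interaction s A E =
    (interaction s (E `&` Omega) A + interaction s (E `\` Omega) A)%E.
  have EOE : (E `&` Omega) `&` (E `\` Omega) = set0.
    by rewrite setDE setIACA setICr setI0.
  rewrite (interactionC s mEO mA) (interactionC s mE' mA).
  by rewrite -(interactionUr s mA mEO mE' EOE) setUIDK.
move: (interaction_ge0 s (E `&` Omega) D) (interaction_ge0 s (E `\` Omega) (D
  `&` Omega))
  (interaction_ge0 s (E `&` Omega) A) (interaction_ge0 s (E `\` Omega) A).
move: (interaction s (E `&` Omega) D) (interaction s (E `\` Omega) (D `&`
  Omega))
  (interaction s (E `&` Omega) A) (interaction s (E `\` Omega) A)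
  (interaction s A D) => a1 a3 a2 a4 a5 a1_ge0 a3_ge0 a2_ge0 a4_ge0.
rewrite addeACA => fin.
have fin13 : (a1 + a3)%E \is a fin_num.
  rewrite ge0_fin_numE ?adde_ge0//; apply: le_lt_trans fin.
  by rewrite leeDl// adde_ge0.
rewrite [(a1 + a5 + a3)%E]addeAC leeD2lE// => le; split=> //.
by apply: le_lt_trans fin; rewrite leeDr// adde_ge0.
Qed.

(** Monotone convergence, in the inner and then the outer integral, along the levels beyond [m0]. *)
Lemma min_kernel_limit s A B (a b : \bar R) (m0 : R) :
  measurable A -> measurable B -> a \is a fin_num ->
  (forall k : nat, m0 <= k%:R ->
    (\int[lebesgue]_(x in A) \int[lebesgue]_(y in B)
       (min_kernel s k%:R (x : 'rV[R]_n) y)%:E + a <= b)%E) ->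
  (interaction s A B + a <= b)%E.
Proof.
move=> mA mB afin leb; pose k0 := (Num.truncn m0).+1.
pose f (k : nat) (u : T * T) := (min_kernel s (k0 +
  k)%:R (u.1 : 'rV[R]_n) u.2)%:E.
have f0 k u : (0 <= f k u)%E by rewrite lee_fin min_kernel_ge0.
have mf k : measurable_fun [set: T * T] (f k).
  exact: measurable_min_kernel measurable_fst measurable_snd.
have nf u : nondecreasing_seq (f^~ u).
  move=> j k jk; rewrite lee_fin le_min ge_min lexx/= ge_min orbC.
  by rewrite ler_nat leq_add2l jk.
(* The kernel value is a real number even on the diagonal, so the truncations are eventually
   constant at each pair. *)
have fK u : limn (f^~ u) = (frac_kernel s (u.1 : 'rV[R]_n) u.2)%:E.
  apply/cvg_lim => //; apply: cvg_near_cst.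
  near=> k; congr (_%:E); rewrite /f /min_kernel min_l//.
  apply: (@le_trans _ _ k%:R); last by rewrite ler_nat leq_addl.
  near: k; exact: nbhs_infty_ger.
pose g k x := (\int[lebesgue]_(y in B) f k (x, y))%E.
have mfx k (x : T) : measurable_fun B (fun y => f k (x, y)).
  by apply: measurable_funTS; exact: measurable_min_kernelr.
have mg k : measurable_fun A (g k).
  by apply: measurable_funTS; exact: measurable_inner_integral.
have g0 k x : (0 <= g k x)%E by exact: integral_ge0.
have ng x : nondecreasing_seq (g^~ x).
  by move=> j k jk; apply: ge0_le_integral => // y _; exact: nf.
have gK (x : T) : limn (g^~ x) =
  (\int[lebesgue]_(y in B) (frac_kernel s (x : 'rV[R]_n) y)%:E)%E.
  transitivity (\int[lebesgue]_(y in B) limn (fun k => f k (x, y)))%E.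
    apply: esym; apply: monotone_convergence.
    - exact: mB.
    - by move=> k; exact: mfx.
    - by move=> k y _; exact: f0.
    - by move=> y _; exact: nf.
  by apply: eq_integral => y _; rewrite fK.
have -> : interaction s A B = limn (fun k => \int[lebesgue]_(x in A) g k x)%E.
  transitivity (\int[lebesgue]_(x in A) limn (g^~ x))%E.
    by apply: eq_integral => x _; rewrite gK.
  apply: monotone_convergence; [exact: mA|exact: mg|..].
  - by move=> k x _; exact: g0.
  - by move=> x _; exact: ng.
rewrite -leeBrDr//; apply: lime_le.
  apply: ereal_nondecreasing_is_cvgn => j k jk; apply: ge0_le_integral.
  - exact: mA.
  - by move=> x _; exact: g0.
  - exact: mg.
  - exact: mg.
  - by move=> x _; exact: ng.
apply: nearW => k; rewrite leeBrDr//; apply: leb.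
by rewrite (le_trans (ltW (truncnS_gt m0)))// ler_nat leq_addr.
Unshelve. all: by end_near. Qed.

(** Exchanging the variables on A x A swaps the regions phi z < phi y and phi y < phi z, and the
    kernel is symmetric, so by Tonelli the two extra terms have equal integrals and cancel. *)
Lemma calibration_integrated s m A E (phi : T -> R) (b : R) :
  0 <= m -> 0 <= b -> measurable A -> measurable E -> measurable_fun setT phi ->
  (lebesgue A < +oo)%E ->
  (forall z : T, A z ->
    \int[lebesgue]_(y in ~` (E `|` A)) (min_kernel s m (z : 'rV[R]_n) y)%:E +
    \int[lebesgue]_(y in A `&` [set y | (phi z < phi y)%R])
      (min_kernel s m (z : 'rV[R]_n) y)%:E + b%:E <=
    \int[lebesgue]_(y in E) (min_kernel s m (z : 'rV[R]_n) y)%:E +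
    \int[lebesgue]_(y in A `&` [set y | (phi y < phi z)%R])
      (min_kernel s m (z : 'rV[R]_n) y)%:E)%E ->
  (\int[lebesgue]_(z in A) \int[lebesgue]_(y in ~` (E `|` A))
     (min_kernel s m (z : 'rV[R]_n) y)%:E + b%:E * lebesgue A <=
       interaction s A E)%E.
Proof.
move=> m0 b0 mA mE mphi Afin pointwise.
pose K (u : T * T) := (min_kernel s m (u.1 : 'rV[R]_n) u.2)%:E.
have K_ge0 u : (0 <= K u)%E by rewrite lee_fin min_kernel_ge0.
have mK : measurable_fun setT K.
  exact: measurable_min_kernel measurable_fst measurable_snd.
have mKx (x : T) : measurable_fun setT (fun y : T => K (x, y)).
  exact: measurable_min_kernelr.
pose up : set (T * T) := [set u | phi u.1 < phi u.2].
pose dn : set (T * T) := [set u | phi u.2 < phi u.1].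
have mphi1 : measurable_fun setT (fun u : T * T => phi u.1).
  exact: measurableT_comp mphi measurable_fst.
have mphi2 : measurable_fun setT (fun u : T * T => phi u.2).
  exact: measurableT_comp mphi measurable_snd.
have mup : measurable up by exact: measurable_ltr_set.
have mdn : measurable dn by exact: measurable_ltr_set.
have mKup : measurable_fun setT (K \_ up).
  by apply/(measurable_restrictT _ mup); exact: measurable_funTS.
have mKdn : measurable_fun setT (K \_ dn).
  by apply/(measurable_restrictT _ mdn); exact: measurable_funTS.
have Kup0 u : (0 <= (K \_ up) u)%E by apply: erestrict_ge0.
have Kdn0 u : (0 <= (K \_ dn) u)%E by apply: erestrict_ge0.
have upE z : (\int[lebesgue]_(y in A `&` [set y | (phi z < phi y)%R]) K (z, y) =
    \int[lebesgue]_(y in A) (K \_ up) (z, y))%E.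
  by rewrite integral_mkcondr; apply: eq_integral.
have dnE z : (\int[lebesgue]_(y in A `&` [set y | (phi y < phi z)%R]) K (z, y) =
    \int[lebesgue]_(y in A) (K \_ dn) (z, y))%E.
  by rewrite integral_mkcondr; apply: eq_integral.
pose I1 z := (\int[lebesgue]_(y in ~` (E `|` A)) K (z, y))%E.
pose I2 z := (\int[lebesgue]_(y in A) (K \_ up) (z, y))%E.
pose I3 z := (\int[lebesgue]_(y in E) K (z, y))%E.
pose I4 z := (\int[lebesgue]_(y in A) (K \_ dn) (z, y))%E.
have mCEA : measurable (~` (E `|` A)) by exact/measurableC/measurableU.
have mI1 : measurable_fun setT I1 by exact: measurable_inner_integral.
have mI2 : measurable_fun setT I2 by exact: measurable_inner_integral.
have mI3 : measurable_fun setT I3 by exact: measurable_inner_integral.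
have mI4 : measurable_fun setT I4 by exact: measurable_inner_integral.
have I1_ge0 z : (0 <= I1 z)%E by exact: integral_ge0.
have I2_ge0 z : (0 <= I2 z)%E by exact: integral_ge0.
have I3_ge0 z : (0 <= I3 z)%E by exact: integral_ge0.
have I4_ge0 z : (0 <= I4 z)%E by exact: integral_ge0.
have updn y z : (K \_ up) (z, y) = (K \_ dn) (y, z).
  have KC : K (z, y) = K (y, z) by rewrite /K /min_kernel/= frac_kernelC.
  by rewrite /patch KC.
have swap : (\int[lebesgue]_(z in A) I2 z = \int[lebesgue]_(z in A) I4 z)%E.
  transitivity (\int[lebesgue]_(y in A) \int[lebesgue]_(z in A) (K \_ up) (z,
    y))%E.
    exact: (integral_swap mA mA mKup Kup0).
  by apply: eq_integral => y _; apply: eq_integral => z _; rewrite updn.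
have le : (\int[lebesgue]_(z in A) (I1 z + I2 z + b%:E) <=
    \int[lebesgue]_(z in A) (I3 z + I4 z))%E.
  apply: ge0_le_integral; first exact: mA.
  - by move=> z _; apply: adde_ge0; [exact: adde_ge0|rewrite lee_fin].
  - apply: measurable_funTS; apply: emeasurable_funD;
    last exact: measurable_cst.
    exact: (emeasurable_funD mI1 mI2).
  - by apply: measurable_funTS; exact: (emeasurable_funD mI3 mI4).
  - by move=> z /pointwise; rewrite upE dnE.
(* Here the truncation is essential: the kernel is at most [m], so the integral is at most m
   |A|^2. *)
have fin4 : (\int[lebesgue]_(z in A) I4 z)%E \is a fin_num.
  rewrite ge0_fin_numE; last by apply: integral_ge0 => z _; exact: I4_ge0.
  have Afin' : lebesgue A \is a fin_num by rewrite ge0_fin_numE.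
  have I4le z : (I4 z <= (m%:E * lebesgue A))%E.
    rewrite -(integral_cst lebesgue mA m%:E); apply: ge0_le_integral.
    - exact: mA.
    - by move=> y _; exact: Kdn0.
    - apply: measurable_funTS;
      exact: measurableT_comp mKdn (measurable_pair1 z).
    - exact: measurable_cst.
    - move=> y _; rewrite /patch; case: ifP => _; last by rewrite lee_fin.
      by rewrite lee_fin ge_min lexx orbT.
  apply: (@le_lt_trans _ _ (\int[lebesgue]_(z in A) (cst (m%:E * lebesgue A)
    z))%E).
    apply: ge0_le_integral; first exact: mA.
    - by move=> z _; exact: I4_ge0.
    - exact: measurable_funTS.
    - exact: measurable_cst.
    - by move=> z _; exact: I4le.
  rewrite (integral_cst lebesgue mA); apply: lte_mul_pinfty => //.
    by rewrite mule_ge0.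
  by rewrite fin_numM.
have I12_ge0 z : (0 <= I1 z + I2 z)%E by rewrite adde_ge0.
have mI12 : measurable_fun setT (fun z =>
  I1 z + I2 z)%E by exact: (emeasurable_funD mI1 mI2).
have D1 : (\int[lebesgue]_(z in A) (I1 z + I2 z + b%:E) =
    \int[lebesgue]_(z in A) I1 z + \int[lebesgue]_(z in A) I2 z +
      b%:E * lebesgue A)%E.
  rewrite -(integral_cst lebesgue mA b%:E) -(ge0_integralD lebesgue mA).
  - apply: (ge0_integralD lebesgue mA); [by []|exact: measurable_funTS|by []|].
    exact: measurable_cst.
  - by [].
  - exact: measurable_funTS.
  - by [].
  - exact: measurable_funTS.
have D2 : (\int[lebesgue]_(z in A) (I3 z + I4 z) =
    \int[lebesgue]_(z in A) I3 z + \int[lebesgue]_(z in A) I4 z)%E.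
  by apply: (ge0_integralD lebesgue mA); [by []|exact: measurable_funTS|by []|
    exact: measurable_funTS].
move: le; rewrite D1 D2 swap [leLHS]addeAC (leeD2rE _ _ fin4) => le.
apply: (le_trans le); apply: ge0_le_integral; first exact: mA.
- by move=> z _; exact: I3_ge0.
- exact: measurable_funTS.
- apply: measurable_funTS.
  exact: (measurable_inner_integral mE (mK2 s) (fun u => K0 s u.1 u.2)).
- move=> z _; apply: ge0_le_integral; first exact: mE.
  + by move=> y _; exact: K_ge0.
  + exact: measurable_funTS.
  + exact/measurable_funTS/mK1.
  + by move=> y _; rewrite lee_fin min_kernel_le.
Qed.

End interaction.

(** * The Euler-Lagrange inequality *)

Section final.
Context {R : realType}.

Lemma limf_esup_at_right_gt (f : R -> \bar R) (a d0 b : R) : a < d0 ->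
  (b%:E < limf_esup f a^'+)%E -> exists2 d, a < d < d0 & (b%:E < f d)%E.
Proof.
move=> ad0; rewrite limf_esupE => lt_b.
have V : a^'+ [set d | a < d < d0].
  near=> d; apply/andP; split; near: d;
    [exact: nbhs_right_gt|exact: nbhs_right_lt].
have : (b%:E < ereal_sup (f @` [set d | (a < d < d0)%R]))%E.
  by apply: lt_le_trans lt_b _; apply: ereal_inf_lbound;
    exists [set d | a < d < d0].
by move=> /ereal_sup_gt[_ [d ad <-] bf]; exists d.
Unshelve. all: by end_near. Qed.

Lemma powR_small (p C e : R) : 0 < p -> 0 < C -> 0 < e ->
  exists2 d0, 0 < d0 & forall d, 0 < d <= d0 -> C * d `^ p <= e.
Proof.
move=> p0 C0 e0; exists ((e / C) `^ p^-1) => [|d /andP[d0 dd]].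
  by rewrite powR_gt0// divr_gt0.
rewrite mulrC -ler_pdivlMr//.
have <- : ((e / C) `^ p^-1) `^ p = e / C.
  have eC0 : 0 <= e / C by rewrite ltW// divr_gt0.
  by rewrite -powRrM mulVf ?(gt_eqF p0)// powRr1.
apply: ge0_ler_powR => //; first exact: ltW.
  by rewrite nnegrE ltW.
by rewrite nnegrE powR_ge0.
Qed.

Context {n : nat}.
Local Notation T := (caratheodory_type (@lebesgue_outer R n)).
Implicit Types (x c z : 'rV[R]_n) (E : set T).

Lemma normalized_boundary_diff_gt0 E x (rho : R) : normalized E -> measurable E
  ->
  boundary (E : set 'rV[R]_n) x -> 0 < rho ->
  (0 < lebesgue ((eball x rho : set T) `\` E))%E.
Proof.
move=> [_ _ bE] mE; rewrite bE => /(_ rho) h rho0;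
  have /andP[_ lt_vol] := h rho0.
rewrite lt0e measure_ge0 andbT; apply/eqP => diff0.
have := ball_volume_le x rho0; rewrite leNgt => /negP; apply.
apply: le_lt_trans lt_vol.
have cover : eball x rho `<=` (E `&` eball x rho) `|` ((eball x rho : set T)
  `\` E).
  by move=> y yx; have [Ey|Ey] := pselect (E y); [left|right].
apply: (le_trans (le_lebesgue_outer cover)).
apply: (le_trans (outer_measureU2 (@lebesgue_outer R n) _ _)).
rewrite [leLHS](_ : _ = lebesgue (E `&` eball x rho) + 0)%E;
  first by rewrite adde0.
by congr (_ + _)%E; exact: diff0.
Qed.

(** The gradient is 2 (x - c) + 4 (z - x), and the second term takes away at most half of the first.
    Thus the lower bound at [x] holds at every [z] in A. *)
Lemma bump_grad_coord_ge c x z (i : 'I_n) (tau : R) :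
  enorm (z - x) <= tau -> 4 * tau <= `|(x - c) ord0 i| ->
  `|(x - c) ord0 i| <= `|bump_grad c x z ord0 i|.
Proof.
move=> zx tau_le; have zxi := le_trans (coord_le_enorm (z - x) i) zx.
have -> : bump_grad c x z ord0 i = 2 * (x - c) ord0 i + 4 * (z - x) ord0 i.
  by rewrite /bump_grad !mxE; ring.
have := lerB_normD (2 * (x - c) ord0 i) (4 * (z - x) ord0 i).
by rewrite !normrM !normr_nat; lra.
Qed.

Lemma bump_lt_eball c x y (r tau : R) : 0 < tau -> 0 < r ->
  r <= enorm (y - c) -> bump c x y < r ^+ 2 + tau ^+ 2 -> eball x tau y.
Proof.
move=> tau0 r0 rc lev; rewrite /eball/=.
rewrite -(@ltr_pXn2r _ 2)// ?nnegrE ?enorm_ge0 ?ltW//.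
have : r ^+ 2 <= enorm (y - c) ^+ 2 by rewrite ler_pXn2r ?nnegrE ?enorm_ge0
  ?(ltW r0).
by move: lev; rewrite /bump; lra.
Qed.

Lemma eball_bump_lt c x (r tau : R) : 0 < tau -> 0 < r -> enorm (x - c) <= r ->
  exists2 rho : R, 0 < rho &
    forall y, eball x rho y -> bump c x y < r ^+ 2 + tau ^+ 2.
Proof.
(* On the ball of radius rho, phi is below (r + rho)^2 + rho^2, and rho <= 1 gives 2 r rho + 2 rho^2
   <= rho (2 r + 2) <= tau^2. *)
move=> tau0 r0 xc; pose rho := Num.min 1 (tau ^+ 2 / (2 * r + 2)).
have den0 : 0 < 2 * r + 2 by lra.
have rho0 : 0 < rho by rewrite lt_min ltr01 divr_gt0// exprn_gt0.
have rho1 : rho <= 1 by rewrite ge_min lexx.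
have rhotau : rho * (2 * r + 2) <= tau ^+ 2.
  by rewrite -ler_pdivlMr// ge_min lexx orbT.
exists rho => // y yx; rewrite /eball/= in yx.
have yc : enorm (y - c) <= r + rho.
  by have := enormB_triangle x y c; lra.
have yc2 : enorm (y - c) ^+ 2 <= (r + rho) ^+ 2.
  by rewrite ler_pXn2r ?nnegrE ?enorm_ge0 ?addr_ge0 ?(ltW r0) ?(ltW rho0).
have yx2 : enorm (y - x) ^+ 2 < rho ^+ 2.
  by rewrite ltr_pXn2r ?nnegrE ?enorm_ge0 ?(ltW rho0).
have : rho ^+ 2 <= rho by rewrite expr2 ger_pMl.
by rewrite /bump; nra.
Qed.

End final.

Theorem theorem0p1 (R : realType) (n : nat) (s : R) (E Omega : set 'rV[R]_n)
    (x : 'rV[R]_n) :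
  0 < s < 1 ->
  open Omega ->
  normalized E ->
  s_minimal s E Omega ->
  (boundary E `&` Omega) x ->
  interior_tangent_ball (E `&` Omega) x ->
  (limf_esup (truncated_curvature s E x) 0^'+ <= 0)%E.
Proof.
move=> s01 oO normE minE [bx Ox] [c [r [r0 ballE ballx]]].
have /andP[s0 s1] := s01.
have [mE _ _] := minE; have mO := open_lebesgue_measurable oO.
pose T : measurableType _ := caratheodory_type (@lebesgue_outer R n).
rewrite leNgt; apply/negP => pos.
have [xc_le xc_neq] := boundary_eball r0 ballx.
have [i xci] : exists i, (x - c) ord0 i != 0.
  by apply: exists_coord_neq0; rewrite subr_eq0.
pose m1 := `|(x - c) ord0 i|; have m10 : 0 < m1 by rewrite normr_gt0.
have [C C0 slabC] := slab_kernel_integral_le i m10 s01.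
(* The limsup may be infinite: [b] is half of it when finite and 1 otherwise. *)
have [b b0 blim] : exists2 b : R, 0 < b &
    (b%:E < limf_esup (truncated_curvature s E x) 0^'+)%E.
  case: (limf_esup _ _) pos => [u|_|]//; last by exists 1 => //; rewrite ltry.
  by rewrite lte_fin => u0; exists (u / 2); rewrite ?lte_fin; lra.
have [d0 d00 d0C] : exists2 d0, 0 < d0 &
    forall d, 0 < d <= d0 -> C * d `^ (1 - s) <= b / 8.
  by apply: powR_small => //; [rewrite subr_gt0|rewrite divr_gt0].
have [delta /andP[delta0 delta_lt] bdelta] := limf_esup_at_right_gt d00 blim.
pose M := fine (\int[lebesgue]_(y in far x delta) (frac_kernel s x y)%:E)%E.
have M0 : 0 <= M.
  by apply: fine_ge0; apply: integral_ge0 => y _;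
    rewrite lee_fin frac_kernel_ge0.
have leM : (\int[lebesgue]_(y in far x delta) (frac_kernel s x y)%:E <= M%:E)%E.
  rewrite fineK// ge0_fin_numE; first exact: far_kernel_integral_lty.
  by apply: integral_ge0 => y _; rewrite lee_fin frac_kernel_ge0.
(* The loss 3 eta M is then at most b / 2; [M + 1] avoids dividing by 0. *)
pose eta := Num.min 2^-1 (b / (6 * (M + 1))).
have M1 : 0 < 6 * (M + 1) by lra.
have eta0 : 0 < eta by rewrite lt_min invr_gt0 ltr0n divr_gt0.
have eta2 : eta <= 2^-1 by rewrite ge_min lexx.
have etaM : 3 * eta * M <= b / 2.
  have : eta * (6 * (M + 1)) <= b by rewrite -ler_pdivlMr// ge_min lexx orbT.
  by move=> ?; nra.
pose a := (delta / 2) `^ (n%:R + s).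
have a0 : 0 < a by rewrite powR_gt0// divr_gt0.
(* On the ring the kernel is at most 1 / a, so a ring of this volume costs b / 8. *)
have V0 : 0 < b / 8 * a by rewrite mulr_gt0// divr_gt0.
have [tau0 tau00 ringV] := ring_volume_small x delta V0.
have [e e0 eO] := open_eball_subset oO Ox.
(* In order, the upper bounds on tau control the ring volume, the distance from the ring to z, the
   gradient, the inclusion of A in Omega, and the comparison of kernels. *)
have [tau [tau_gt0 tau_tau0 tau_delta tau_m1 [tau_e tau_eta]]] : exists tau,
    [/\ 0 < tau, tau <= tau0, 6 * tau <= delta, 4 * tau <= m1 &
        tau <= e /\ n.+1%:R * (tau / delta) <= eta].
  pose t1 := Num.min tau0 (delta / 6); pose t2 := Num.min (m1 / 4) e.
  pose t3 := eta * delta / n.+1%:R; exists (Num.min (Num.min t1 t2) t3).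
  set tau := Num.min _ _;
    have min_l u v : Num.min u v <= u :> R by rewrite ge_min lexx.
  have min_r u v : Num.min u v <= v :> R by rewrite ge_min lexx orbT.
  have le1 : tau <= t1 := le_trans (min_l _ _) (min_l _ _).
  have le2 : tau <= t2 := le_trans (min_l _ _) (min_r _ _).
  have le3 : tau <= t3 := min_r _ _.
  have t10 : 0 < t1 by rewrite lt_min tau00 divr_gt0.
  have t20 : 0 < t2 by rewrite lt_min e0 divr_gt0.
  have t30 : 0 < t3 by rewrite divr_gt0// mulr_gt0.
  split; first by rewrite lt_min t30 andbT lt_min t10 t20.
  - exact: le_trans le1 (min_l _ _).
  - by rewrite mulrC -ler_pdivlMr//; exact: le_trans le1 (min_r _ _).
  - by rewrite mulrC -ler_pdivlMr//; exact: le_trans le2 (min_l _ _).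
  split; first exact: le_trans le2 (min_r _ _).
  by rewrite mulrA ler_pdivrMr// mulrC -ler_pdivlMr.
pose lev := r ^+ 2 + tau ^+ 2.
pose A : set T := [set y : T | bump c x y < lev] `\` E.
have mA : measurable A.
  apply: measurableD => //.
  exact: (measurable_ltr_set (measurable_bump c x) (measurable_cst lev)).
(* A point of [A] is outside E, hence outside the tangent ball: |y - c| >= r leaves only tau^2 for
   |y - x|^2. *)
have Atau : A `<=` eball x tau.
  move=> y [ylev nEy]; apply: (bump_lt_eball tau_gt0 r0 _ ylev).
  by rewrite leNgt; apply/negP => yc; apply: nEy; exact: (ballE _ yc).1.
have Adelta : A `<=` eball x delta.
  by move=> y /Atau; rewrite /eball/=; lra.
have EA : E `&` A = set0 by rewrite -subset0 => y [Ey [_ nEy]].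
have AO : A `<=` Omega.
  by move=> y /Atau; rewrite /eball/= => yx; apply: eO;
    exact: lt_le_trans tau_e.
have Agt0 : (0 < lebesgue A)%E.
  have [rho rho0 rholev] := eball_bump_lt tau_gt0 r0 xc_le.
  apply: lt_le_trans (normalized_boundary_diff_gt0 normE mE bx rho0) _.
  by apply: le_lebesgue_outer => y [/rholev ylev nEy].
have Alty : (lebesgue A < +oo)%E.
  by apply: le_lt_trans (le_lebesgue_outer Atau) (lebesgue_eball_lty x tau).
have Afin : lebesgue A \is a fin_num by rewrite ge0_fin_numE.
have hcurv := truncated_curvature_gt s0 delta0 mE bdelta.
have key (k : nat) : a^-1 <= k%:R ->
    (\int[lebesgue]_(z in A) \int[lebesgue]_(y in ~` (E `|` A))
       (min_kernel s k%:R (z : 'rV[R]_n) y)%:E + (b / 4)%:E * lebesgue A <=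
     interaction s A E)%E.
  move=> ak; apply: (calibration_integrated (phi := bump c x)) => //.
  - by rewrite divr_ge0// ltW.
  - exact: measurable_bump.
  move=> z Az; have zx : enorm (z - x) <= tau by apply: ltW; exact: Atau.
  apply: (calibration_le (delta := delta) (lev := lev)) => //.
  - exact: Az.1.
  - rewrite (_ : b / 4 + b / 4 = b / 2); last by field.
    apply: (far_estimate (t := tau / delta) (eta := eta) (M := M)) => //.
    + by rewrite divr_ge0// ltW.
    + by rewrite divfK// gt_eqF.
  have grad := bump_grad_coord_ge zx tau_m1.
  have dtau : 0 < delta - tau by lra.
  have slabz := slabC _ z _ grad dtau.
  have ringz := ringV tau; rewrite tau_gt0 tau_tau0 in ringz.
  apply: le_trans (near_above_le_below s0 (ler0n _ _) tau_gt0 tau_delta zx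
    slabz (ringz isT)) _.
  apply: leeD => //; rewrite lee_fin -/a.
  have : C * (delta - tau) `^ (1 - s) <= b / 8.
    by apply: d0C; rewrite dtau/=; lra.
  have -> : a^-1 * (b / 8 * a) = b / 8 by rewrite mulrCA mulVf ?mulr1// gt_eqF.
  by lra.
have [fin_AE le_AE] := s_minimal_exterior minE mO mA AO EA.
have mCEA : measurable (~` (E `|` A) : set T) by exact/measurableC/measurableU.
have bfin : ((b / 4)%:E * lebesgue A)%E \is a fin_num by rewrite fin_numM.
have a_gt0 : (0 < (b / 4)%:E * lebesgue A)%E.
  by rewrite mule_gt0// lte_fin divr_gt0.
have D_le := min_kernel_limit mA mCEA bfin key.
have Dfin : interaction s A (~` (E `|` A)) \is a fin_num.
  rewrite ge0_fin_numE; last exact: interaction_ge0.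
  by apply: le_lt_trans fin_AE; apply: le_trans D_le; rewrite leeDl// ltW.
(* With D = L(A, C(E u A)) finite, this reads D + (b/4) |A| <= D, although |A| > 0. *)
have := le_trans D_le le_AE.
by rewrite -[leRHS]adde0 leeD2lE// leNgt a_gt0.
Qed.
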